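(* Let $U$ and $V$ be real Hilbert spaces, $F\colon U\to V$ a bounded linear operator, and $\mathcal{R}\colon U\to[0,+\infty]$ a convex, lower semi-continuous and coercive functional. Let $v^\dagger\in V$ and let $u^\dagger\in\operatorname{arg\,min}_u\{\mathcal{R}(u): Fu=v^\dagger\}$. Assume that for some $0<\nu\le 1$ there exist $\omega^\dagger\in U$ and $$\xi^\dagger=(F^*F)^\nu\omega^\dagger\in\partial\mathcal{R}(u^\dagger).$$ For $\alpha>0$ and $v^\delta\in V$, let $u_\alpha^\delta$ denote any minimiser of $\mathcal{T}_\alpha(u,v^\delta)=\frac12\lVert Fu-v^\delta\rVert^2+\alpha\mathcal{R}(u)$. Then the following convergence rates hold as $\delta\to0$ (with $\sim$ and $\lesssim$ in the uniform sense specified in the context): (i) If $0<\nu\le 1/2$, then $$\mathcal{D}_{\xi^\dagger}(u_\alpha^\delta,u^\dagger)\lesssim\delta^{2\nu}\quad\text{for}\quad\alpha\sim\delta^{2-2\nu}.$$ (ii) If $\mathcal{R}$ is locally $p$-convex for some $1\le p<+\infty$ and $0<\nu\le1/2$, then $$\mathcal{D}_{\xi^\dagger}(u_\alpha^\delta,u^\dagger)\lesssim\delta^{\frac{2\nu p}{p-1+2\nu}}\quad\text{for}\quad\alpha\sim\delta^{\frac{2p-2-2p\nu+4\nu}{p-1+2\nu}}.$$ (iii) If $\mathcal{R}$ is locally $q$-coconvex for some $1\le q<+\infty$ and $1/2\le\nu\le1$, then $$\mathcal{D}^{\mathrm{sym}}_{\xi_\alpha^\delta,\xi^\dagger}(u_\alpha^\delta,u^\dagger)\lesssim\delta^{\frac{2\nu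 q}{1+2\nu q-2\nu}}\quad\text{for}\quad\alpha\sim\delta^{\frac{2+2\nu q-4\nu}{1+2\nu q-2\nu}},$$ where $\xi_\alpha^\delta:=\frac1\alpha F^*(v^\delta-Fu_\alpha^\delta)\in\partial\mathcal{R}(u_\alpha^\delta)$.
   Context: Coercive means $\mathcal{R}(u)\to+\infty$ as $\lVert u\rVert\to\infty$. The subdifferential $\partial\mathcal{R}(u)$ is the set of $\xi\in U$ with $\mathcal{R}(u)<\infty$ and $\mathcal{R}(w)\ge\mathcal{R}(u)+\langle\xi,w-u\rangle$ for all $w\in U$; $\operatorname{dom}\partial\mathcal{R}=\{u:\partial\mathcal{R}(u)\ne\emptyset\}$. Fractional powers $(F^*F)^\nu$ are defined by the spectral calculus. Bregman distance: for $\xi\in\partial\mathcal{R}(u)$, $\mathcal{D}_\xi(\tilde u,u)=\mathcal{R}(\tilde u)-\mathcal{R}(u)-\langle\xi,\tilde u-u\rangle$. Symmetric Bregman distance: for $\xi_1\in\partial\mathcal{R}(u_1)$ and $\xi_2\in\partial\mathcal{R}(u_2)$, $\mathcal{D}^{\mathrm{sym}}_{\xi_1,\xi_2}(u_1,u_2)=\langle\xi_1-\xi_2,u_1-u_2\rangle$. The first order optimality condition for $u_\alpha^\delta$ says precisely that $\frac1\alpha F^*(v^\delta-Fu_\alpha^\delta)\in\partial\mathcal{R}(u_\alpha^\delta)$. Locally $p$-convex ($1\le p<\infty$): for each $u\in\operatorname{dom}\partial\mathcal{R}$ and every $\rho>0$ there is a constant $C=C(u,\rho)>0$ such that $C\lVert\tilde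 u-u\rVert^p\le\mathcal{D}_\xi(\tilde u,u)$ for all $\xi\in\partial\mathcal{R}(u)$ and all $\tilde u\in U$ with $\lVert\tilde u-u\rVert\le\rho$. Locally $q$-coconvex ($1\le q<\infty$): for every $\rho>0$ there is a constant $C=C(\rho)>0$ such that $C\lVert\xi_1-\xi_2\rVert^q\le\langle\xi_1-\xi_2,u_1-u_2\rangle$ for all $u_1,u_2\in\operatorname{dom}\partial\mathcal{R}$ with $\lVert u_i\rVert\le\rho$ and all $\xi_1\in\partial\mathcal{R}(u_1)$, $\xi_2\in\partial\mathcal{R}(u_2)$. Meaning of the rates: ''$D\lesssim\delta^b$ for $\alpha\sim\delta^a$'' means that for all constants $0<c\le c'$ there exist $\delta_0>0$ and $C>0$ (which may depend on all fixed data $F,\mathcal{R},u^\dagger,\xi^\dagger,\omega^\dagger,\nu,p,q,c,c'$) such that $D\le C\delta^b$ for all $0<\delta\le\delta_0$, all $\alpha$ with $c\,\delta^a\le\alpha\le c'\delta^a$, all $v^\delta\in V$ with $\lVert v^\delta-v^\dagger\rVert\le\delta$, and all minimisers $u_\alpha^\delta$ of $\mathcal{T}_\alpha(\cdot,v^\delta)$. *)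

(* Defs.v *)
From HB Require Import structures.
From mathcomp Require Import all_boot all_order all_algebra.
From mathcomp Require Import all_classical all_reals all_analysis.

Set Implicit Arguments.
Unset Strict Implicit.
Unset Printing Implicit Defensive.

Import Order.TTheory GRing.Theory Num.Theory.
Import numFieldNormedType.Exports.

Local Open Scope classical_set_scope.
Local Open Scope ring_scope.

(* A real Hilbert space is a complete normed space whose norm comes from an
   inner product. *)
HB.mixin Record CompleteNormedModule_isHilbert (R : realType) U
    of CompleteNormedModule R U := {
  inner : U -> U -> R ;
  innerC : forall u w, inner u w = inner w u ;
  innerDl : forall u1 u2 w, inner (u1 + u2) w = inner u1 w + inner u2 w ;
  innerZl : forall (a : R) u w, inner (a *: u) w = a * inner u w ;
  inner_normE : forall u, inner u u = `|u| ^+ 2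
}.

#[short(type="hilbertType")]
HB.structure Definition Hilbert (R : realType) :=
  {U of CompleteNormedModule R U & CompleteNormedModule_isHilbert R U}.

Section Operators.
Context {R : realType}.

Definition bounded_op {U V : normedModType R} (F : U -> V) : Prop :=
  exists M : R, forall u, `|F u| <= M * `|u|.

(* For F bounded linear, the Riesz representation theorem says that exactly one
   w satisfies the defining condition. *)
Definition adjoint {U V : hilbertType R} (F : U -> V) (v : V) : U :=
  xget 0 [set w | forall u, inner (F u) v = inner u w].

Definition poly_op {U : lmodType R} (p : {poly R}) (A : U -> U) (x : U) : U :=
  \sum_(i < size p) p`_i *: iter i A x.

(* Real spectrum; for a self-adjoint A this is the whole spectrum of its
   complexification. *)
Definition spectrum {U : normedModType R} (A : U -> U) : set R :=
  [set l | ~ exists B : {linear U -> U}, [/\ bounded_op B,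
      forall x, B (A x - l *: x) = x & forall x, A (B x) - l *: B x = x]].

Definition is_functional_calculus {U : normedModType R} (A : U -> U)
    (f : R -> R) (B : U -> U) : Prop :=
  exists p : nat -> {poly R},
    (forall e : R, 0 < e -> \forall n \near \oo,
       forall t, spectrum A t -> `|(p n).[t] - f t| <= e) /\
    (forall e : R, 0 < e -> \forall n \near \oo,
       forall x, `|poly_op (p n) A x - B x| <= e * `|x|).

(* The continuous functional calculus: f(A) is the limit in operator norm of
   p_n(A) for polynomials p_n converging to f uniformly on the spectrum.  If A
   is bounded and self-adjoint and f is continuous on the spectrum, then this
   limit exists and does not depend on the sequence p_n. *)
Definition functional_calculus {U : normedModType R} (A : U -> U)
    (f : R -> R) : U -> U :=
  xget (fun=> 0) [set B | is_functional_calculus A f B].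

(* Meant for positive self-adjoint A, whose spectrum lies in [0, +oo[; the
   values of powR at negative reals are then irrelevant. *)
Definition op_power {U : normedModType R} (A : U -> U) (nu : R) : U -> U :=
  functional_calculus A (fun t => t `^ nu).

End Operators.

Section Functionals.
Context {R : realType} {U : hilbertType R}.
Implicit Types (J : U -> \bar R) (u w xi : U).

(* The endpoints t = 0, 1 are trivial and are left out, so no product of 0 and
   +oo occurs. *)
Definition convex_functional J : Prop :=
  forall u w (t : R), 0 < t -> t < 1 ->
    (J (t *: u + (1 - t) *: w)%R <= t%:E * J u + (1 - t)%:E * J w)%E.

Definition coercive J : Prop :=
  forall M : R, exists r : R, forall u, r <= `|u| -> (M%:E <= J u)%E.

Definition subdifferential J u : set U :=
  [set xi | (J u < +oo)%E /\
            forall w, (J u + (inner xi (w - u)%R)%:E <= J w)%E].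

Definition dom_subdifferential J : set U :=
  [set u | subdifferential J u !=set0].

Definition bregman J xi w u : \bar R :=
  (J w - J u - (inner xi (w - u)%R)%:E)%E.

Definition bregman_sym xi1 xi2 u1 u2 : R := inner (xi1 - xi2) (u1 - u2).

Definition locally_convex_of_order (p : R) J : Prop :=
  forall u, dom_subdifferential J u -> forall rho : R, 0 < rho ->
  exists2 C : R, 0 < C &
    forall xi w, subdifferential J u xi -> `|w - u| <= rho ->
      ((C * `|w - u| `^ p)%:E <= bregman J xi w u)%E.

Definition locally_coconvex_of_order (q : R) J : Prop :=
  forall rho : R, 0 < rho ->
  exists2 C : R, 0 < C &
    forall u1 u2 xi1 xi2,
      dom_subdifferential J u1 -> dom_subdifferential J u2 ->
      `|u1| <= rho -> `|u2| <= rho ->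
      subdifferential J u1 xi1 -> subdifferential J u2 xi2 ->
      C * `|xi1 - xi2| `^ q <= inner (xi1 - xi2) (u1 - u2).

End Functionals.

Section Tikhonov.
Context {R : realType} {U V : hilbertType R}.
Variables (F : U -> V) (J : U -> \bar R).

Definition constrained_minimiser (v : V) (u : U) : Prop :=
  F u = v /\ forall w, F w = v -> (J u <= J w)%E.

Definition tikhonov (alpha : R) (v : V) (u : U) : \bar R :=
  ((2^-1 * `|F u - v| ^+ 2)%:E + alpha%:E * J u)%E.

Definition tikhonov_minimiser (alpha : R) (v : V) (u : U) : Prop :=
  forall w, (tikhonov alpha v u <= tikhonov alpha v w)%E.

Definition tikhonov_subgradient (alpha : R) (v : V) (u : U) : U :=
  alpha^-1 *: adjoint F (v - F u).

(* "D <~ delta^b for alpha ~ delta^a", where D alpha v u is the error of the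
   minimiser u for the parameter alpha and the data v. *)
Definition convergence_rate (vdag : V) (a b : R) (D : R -> V -> U -> \bar R) :
    Prop :=
  forall c c' : R, 0 < c -> c <= c' ->
  exists delta0 C : R, [/\ 0 < delta0, 0 < C &
    forall (delta alpha : R) (v : V) (u : U),
      0 < delta -> delta <= delta0 ->
      c * delta `^ a <= alpha -> alpha <= c' * delta `^ a ->
      `|v - vdag| <= delta ->
      tikhonov_minimiser alpha v u ->
      (D alpha v u <= (C * delta `^ b)%:E)%E].

End Tikhonov.

(* Main.v *)
From HB Require Import structures.
Require Import Defs.
From mathcomp Require Import all_boot all_order all_algebra.
From mathcomp Require Import all_classical all_reals all_analysis.
From mathcomp Require Import ring lra.
From mathcomp.real_closed Require Import complex.

Set Implicit Arguments.
Unset Strict Implicit.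
Unset Printing Implicit Defensive.

Import Order.TTheory GRing.Theory Num.Theory.
Import numFieldNormedType.Exports.

Local Open Scope classical_set_scope.
Local Open Scope ring_scope.

(** Write e = u - u^dag for a minimiser u and A = F^* F.  Everything rests on
turning the source condition xi^dag = A^nu omega into an interpolation
inequality.  Since A^nu is symmetric,
<xi^dag, x>^2 = <omega, A^nu x>^2 <= |omega|^2 <A^(2 nu) x, x>.  For nu <= 1/2
the function t^(2 nu) lies below each of its tangents; the tangent at s gives a
bound by a combination of <A x, x> = |F x|^2 and |x|^2, and the best s gives
|<xi^dag, x>| <= |omega| |F x|^(2 nu) |x|^(1 - 2 nu) ([source_low]).  For
nu >= 1/2 one factor t is split off first, and the result is
|<xi^dag, x>| <= |omega| |A x|^(2 nu - 1) |F x|^(2 - 2 nu) ([source_high]).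

The functional calculus is only used through polynomials: the estimates follow
if a polynomial that is nonnegative on the spectrum gives a nonnegative
quadratic form ([poly_op_ge0]).  The infimum m of the quadratic form of p(A) is
attained in the sense that p(A) - m is not bounded below; as a real polynomial
factors into linear and positive definite quadratic factors, some A - l with
p(l) = m is not bounded below, so that l is in the spectrum.

For the rates (i) and (ii), comparison of u with u^dag in the Tikhonov
functional gives
alpha D + |F e|^2 / 4 <= delta^2 - alpha <xi^dag, e>, with D the Bregman
distance.  The factor |e|^(1 - 2 nu) of [source_low] is bounded by coercivity
in (i) and by a power of D in (ii), and Young's inequality absorbs the powers
of |F e| and D ([rate_low_smoothness], [rate_of_absorption]).

For (iii), xi^dag = F^* eta formally, and xi_alpha - xi^dag = F^* zeta with
zeta = (v - F u) / alpha - eta.  Testing with zeta gives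
D + alpha |zeta|^2 <= delta |zeta| + alpha |<zeta, eta>|.  Here
<zeta, eta> = <A^(-1) F^* zeta, xi^dag>, and [source_high] bounds it by
|zeta|^(2 - 2 nu) |xi_alpha - xi^dag|^(2 nu - 1), where coconvexity bounds
|xi_alpha - xi^dag| by a power of D.  The inverse of A is replaced by
(A + s)^(-1) with s small enough ([bregman_sym_estimate]).  The absorption
fails for q = nu = 1 alone, but a coercive functional is locally 1-coconvex
only on the zero space ([coconvex_order1_trivial]). *)

(** * Inner products *)

Section InnerProduct.
Context {R : realType} {U : hilbertType R}.
Implicit Types u w x : U.

Lemma innerDr u w x : inner u (w + x) = inner u w + inner u x.
Proof. by rewrite innerC innerDl !(innerC u). Qed.

Lemma innerZr (a : R) u w : inner u (a *: w) = a * inner u w.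
Proof. by rewrite innerC innerZl (innerC u). Qed.

Lemma inner0l u : inner 0 u = 0.
Proof. by rewrite -(scale0r u) innerZl mul0r. Qed.

Lemma inner0r u : inner u 0 = 0.
Proof. by rewrite innerC inner0l. Qed.

Lemma innerNl u w : inner (- u) w = - inner u w.
Proof. by rewrite -scaleN1r innerZl mulN1r. Qed.

Lemma innerNr u w : inner u (- w) = - inner u w.
Proof. by rewrite innerC innerNl innerC. Qed.

Lemma innerBl u w x : inner (u - w) x = inner u x - inner w x.
Proof. by rewrite innerDl innerNl. Qed.

Lemma innerBr u w x : inner u (w - x) = inner u w - inner u x.
Proof. by rewrite innerDr innerNr. Qed.

Lemma normD_sqr u w : `|u + w| ^+ 2 = `|u| ^+ 2 + 2 * inner u w + `|w| ^+ 2.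
Proof. by rewrite -!inner_normE innerDl !innerDr (innerC w u); ring. Qed.

Lemma normB_sqr u w : `|u - w| ^+ 2 = `|u| ^+ 2 - 2 * inner u w + `|w| ^+ 2.
Proof. by rewrite normD_sqr normrN innerNr; ring. Qed.

Lemma normZ_sqr (a : R) u : `|a *: u| ^+ 2 = a ^+ 2 * `|u| ^+ 2.
Proof. by rewrite -!inner_normE innerZl innerZr; ring. Qed.

Lemma inner_eq0 u : inner u u = 0 -> u = 0.
Proof.
by rewrite inner_normE => /eqP; rewrite sqrf_eq0 normr_eq0 => /eqP.
Qed.

Lemma inner_ext u w : (forall x, inner x u = inner x w) -> u = w.
Proof.
move=> h; apply/eqP; rewrite -subr_eq0; apply/eqP; apply: inner_eq0.
by rewrite innerBr h subrr.
Qed.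

Lemma inner_sqr_le u w : inner u w ^+ 2 <= `|u| ^+ 2 * `|w| ^+ 2.
Proof.
have [->|w0] := eqVneq w 0; first by rewrite inner0r normr0 !expr0n /= mulr0.
have W : 0 < `|w| ^+ 2 by rewrite exprn_gt0 // normr_gt0.
have := sqr_ge0 `|u - (inner u w / `|w| ^+ 2) *: w|.
rewrite normB_sqr normZ_sqr innerZr -(ler_pM2r W) mul0r.
suff -> : (`|u| ^+ 2 - 2 * (inner u w / `|w| ^+ 2 * inner u w) +
   (inner u w / `|w| ^+ 2) ^+ 2 * `|w| ^+ 2) * `|w| ^+ 2 =
   `|u| ^+ 2 * `|w| ^+ 2 - inner u w ^+ 2 by rewrite subr_ge0.
by field; rewrite normr_eq0.
Qed.

Lemma cauchy_schwarz u w : `|inner u w| <= `|u| * `|w|.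
Proof.
rewrite -(@ler_pXn2r _ 2) // ?nnegrE ?mulr_ge0 //.
by rewrite -normrX ger0_norm ?sqr_ge0 // exprMn inner_sqr_le.
Qed.

Lemma inner_le u w : inner u w <= `|u| * `|w|.
Proof. exact: le_trans (ler_norm _) (cauchy_schwarz u w). Qed.

Lemma inner_ge u w : - (`|u| * `|w|) <= inner u w.
Proof. by have := cauchy_schwarz u w; rewrite ler_norml => /andP[]. Qed.

Lemma parallelogram u w :
  `|u + w| ^+ 2 + `|u - w| ^+ 2 = 2 * (`|u| ^+ 2 + `|w| ^+ 2).
Proof. by rewrite normD_sqr normB_sqr; ring. Qed.

End InnerProduct.

(** * Continuity and semicontinuity *)

Section Continuity.
Context {R : realType}.

Lemma bounded_opP {U V : normedModType R} (F : U -> V) :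
  bounded_op F -> exists2 M : R, 0 < M & forall u, `|F u| <= M * `|u|.
Proof.
move=> [M FM]; exists (`|M| + 1); first by rewrite ltr_pwDr.
move=> u; apply: (le_trans (FM u)); apply: ler_wpM2r => //.
by have := ler_norm M; lra.
Qed.

Lemma bounded_op_continuous {U V : normedModType R} (F : {linear U -> V}) :
  bounded_op F -> continuous F.
Proof.
move=> /bounded_opP [M M0 FM]; apply/linear_bounded_continuous/bounded_funP.
move=> r; exists (M * r) => x xr; apply: (le_trans (FM x)).
by rewrite ler_pM2l.
Qed.

Lemma inner_continuous {V : hilbertType R} (v : V) :
  continuous (fun x : V => inner x v).
Proof.
have -> : (fun x : V => inner x v) =
    (fun x => 2^-1 * (`|x + v| ^+ 2 - `|x| ^+ 2 - `|v| ^+ 2)).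
  by apply/funext => x; rewrite normD_sqr; field.
have sqr_norm_cvg (y : V) (f : V -> V) : f z @[z --> y] --> f y ->
    `|f z| ^+ 2 @[z --> y] --> `|f y| ^+ 2.
  by move=> h; rewrite expr2; under eq_fun do rewrite expr2;
     apply: cvgM; exact: cvg_norm.
move=> x; apply: cvgM; first exact: cvg_cst.
apply: cvgB; last exact: cvg_cst.
apply: cvgB; apply: (sqr_norm_cvg x); last exact: cvg_id.
by apply: cvgD; [exact: cvg_id|exact: cvg_cst].
Qed.

Lemma sqr_norm_continuous {U V : normedModType R} (f : U -> V) :
  continuous f -> continuous (fun x => `|f x| ^+ 2).
Proof.
by move=> h x; rewrite /continuous_at expr2; under eq_fun do rewrite expr2;
   apply: cvgM; apply: cvg_norm; exact: h.
Qed.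

Lemma lte_fin_between (a : R) (x : \bar R) : (a%:E < x)%E ->
  exists2 e : R, 0 < e & ((a + e)%:E < x)%E.
Proof.
case: x => [b| |] //.
  by rewrite lte_fin => ab; exists ((b - a) / 2); rewrite ?lte_fin; lra.
by move=> _; exists 1; rewrite ?ltry.
Qed.

Lemma lower_semicontinuous_addc {U : normedModType R} (J : U -> \bar R)
    (g : U -> R) : lower_semicontinuous J -> continuous g ->
  lower_semicontinuous (fun x => J x + (g x)%:E)%E.
Proof.
move=> Jl gc x a; rewrite -lteBlDr // -EFinB => /lte_fin_between [e e0 ae].
have [V Vx JV] := Jl _ _ ae.
have near_g : nbhs x [set y | `|g x - g y| < e].
  have /cvgrPdist_lt /(_ _ e0) h := gc x.
  exact: h.
exists (V `&` [set y | `|g x - g y| < e]); first exact: filterI.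
move=> y [/JV Jy /= gy]; rewrite -lteBlDr // -EFinB; apply: le_lt_trans Jy.
by rewrite lee_fin; move: gy; rewrite ltr_norml => /andP[? ?]; lra.
Qed.

End Continuity.

(** * Minimisation of strongly convex functionals *)

Section Minimisation.
Context {R : realType} {U : hilbertType R}.

Lemma lin_coef_eq0 (a b : R) : (forall t : R, 0 <= t * a + t ^+ 2 * b) -> a = 0.
Proof.
move=> h; apply/eqP; apply: contraT => a0.
pose c := `|b| + 1.
have c0 : 0 < c by rewrite ltr_pwDr.
(* At this t the two terms sum to a negative multiple of a ^+ 2, as b < 2 c. *)
have := h (- a / (2 * c)); have bc : b <= c by have := ler_norm b; rewrite /c; lra.
have -> : - a / (2 * c) * a + (- a / (2 * c)) ^+ 2 * b =
   a ^+ 2 / (4 * c ^+ 2) * (b - 2 * c) by field; rewrite gt_eqF.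
have A : 0 < a ^+ 2 / (4 * c ^+ 2).
  by rewrite divr_gt0 ?exprn_even_gt0 // mulr_gt0 ?exprn_gt0.
by rewrite pmulr_rge0 //; lra.
Qed.

(** A minimising sequence is Cauchy, because the midpoint of two almost
minimisers would otherwise lie below the infimum; lower semicontinuity then
makes its limit a minimiser. *)
Lemma strongly_convex_minimiser (G : U -> \bar R) (c k : R) : 0 < k ->
  (forall u, c%:E <= G u)%E -> lower_semicontinuous G ->
  (exists u, G u < +oo)%E ->
  (forall u w (a b : R), (G u <= a%:E)%E -> (G w <= b%:E)%E ->
     (G (2^-1 *: (u + w))%R <= ((a + b) / 2 - k * `|u - w| ^+ 2)%:E)%E) ->
  exists u, forall w, (G u <= G w)%E.
Proof.
move=> k0 Gc Glsc [u0 Gu0] mid.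
pose S := [set a : R | exists u, (G u <= a%:E)%E].
have fin u : (G u < +oo)%E -> exists b : R, G u = b%:E.
  by move: (Gc u); case: (G u) => [b| |] // _ _; exists b.
have [b0 Eb0] := fin _ Gu0.
have Slb a : S a -> c <= a.
  by move=> [u ua]; rewrite -lee_fin; exact: le_trans (Gc u) ua.
have Sinf : has_inf S by split; [exists b0, u0; rewrite Eb0|exists c => a /Slb].
pose m := inf S.
have mS a : S a -> m <= a by move=> Sa; apply: ge_inf => //; case: Sinf.
have ex n : exists u, (G u <= (m + n.+1%:R^-1)%:E)%E.
  have n0 : 0 < n.+1%:R^-1 :> R by rewrite invr_gt0.
  have [a [u ua] am] := inf_adherent n0 Sinf.
  by exists u; apply: (le_trans ua); rewrite lee_fin ltW.
have [x xP] := choice ex.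
have dist (n j N : nat) : (N <= n)%N -> (N <= j)%N ->
    `|x n - x j| ^+ 2 <= k^-1 * N.+1%:R^-1.
  move=> Nn Nj; have := mid _ _ _ _ (xP n) (xP j).
  set d : R := _ ^+ 2 => h; have Sh := mS _ (ex_intro (fun u => _) _ h : S _).
  rewrite ler_pdivlMl //.
  have a1 : n.+1%:R^-1 <= N.+1%:R^-1 :> R by rewrite lef_pV2 ?posrE // ler_nat.
  have a2 : j.+1%:R^-1 <= N.+1%:R^-1 :> R by rewrite lef_pV2 ?posrE // ler_nat.
  move: a1 a2 Sh; move: (n.+1%:R^-1) (j.+1%:R^-1) (N.+1%:R^-1) => a b e.
  by move: (m) (d); clear=> *; lra.
have inv_small (e : R) : 0 < e -> exists N, N.+1%:R^-1 < e.
  move=> e0; have [N _ NP] := near_infty_natSinv_lt (PosNum e0).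
  by exists N; exact: NP (leqnn N).
have cx : cvg (x @ \oo).
  apply: cauchy_cvg; apply: cauchy_exP => e e0.
  have [N NP] := inv_small (k * e ^+ 2) (mulr_gt0 k0 (exprn_gt0 2 e0)).
  exists (x N), N => // n /= Nn; rewrite -ball_normE /ball_ /=.
  rewrite -(@ltr_pXn2r _ 2) // ?nnegrE // 1?ltW //.
  by apply: (le_lt_trans (dist _ _ N _ Nn)) => //; rewrite ltr_pdivrMl.
exists (lim (x @ \oo)) => w; rewrite leNgt; apply/negP => Gw.
have [b Eb] := fin w (lt_le_trans Gw (leey _)).
move: Gw; rewrite Eb => /lte_fin_between [e e0 be].
have [V Vx GV] := Glsc _ _ be.
have [N1 _ N1P] := cx _ Vx.
have [N2 N2P] := inv_small e e0.
pose N := maxn N1 N2.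
have G1 := GV _ (N1P N (leq_maxl _ _)).
have := lt_le_trans G1 (xP N); rewrite lte_fin.
have : m <= b by apply: mS; exists w; rewrite Eb.
have : N.+1%:R^-1 <= N2.+1%:R^-1 :> R.
  by rewrite lef_pV2 ?posrE // ler_nat ltnS leq_maxr.
move: (m) (N2.+1%:R^-1) (N.+1%:R^-1) N2P.
by clear=> *; lra.
Qed.

Lemma midpoint_sqr (u w : U) : `|2^-1 *: (u + w)| ^+ 2 =
  2^-1 * (`|u| ^+ 2 + `|w| ^+ 2) - 4^-1 * `|u - w| ^+ 2.
Proof. by rewrite normZ_sqr normD_sqr normB_sqr; field. Qed.

End Minimisation.

(** * Adjoints and resolvents *)

Section Adjoint.
Context {R : realType}.

(** The Riesz representation theorem and the solvability of (F^* F + s) x = L^*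
v at once: x minimises |F x|^2 / 2 + s |x|^2 / 2 - <L x, v>. Taking F = 0 and s
= 1 gives the adjoint of L, and taking the identity for L gives the resolvent
of F^* F. *)
Lemma regularised_normal_equation {U V W : hilbertType R}
    (F : {linear U -> V}) (L : {linear U -> W}) (v : W) (s : R) :
  bounded_op F -> bounded_op L -> 0 < s ->
  exists x, forall u, inner (F x) (F u) + s * inner x u = inner (L u) v.
Proof.
move=> Fb Lb s0.
pose g x := 2^-1 * `|F x| ^+ 2 + s / 2 * `|x| ^+ 2 - inner (L x) v.
have gc : continuous g.
  move=> x; apply: cvgB; last first.
    apply: (@continuous_comp _ _ _ L (fun y => inner y v)).
      exact: bounded_op_continuous.
    exact: inner_continuous.
  apply: cvgD; apply: cvgM; try exact: cvg_cst.
    exact: (sqr_norm_continuous (bounded_op_continuous Fb)).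
  by apply: (@sqr_norm_continuous _ U U id) => y; exact: cvg_id.
have glsc : lower_semicontinuous (EFin \o g).
  have -> : EFin \o g = (fun x => (cst 0%E x) + (g x)%:E)%E.
    by apply/funext => x; rewrite add0e.
  apply: lower_semicontinuous_addc => // x a ax.
  by exists setT => //; exact: filterT.
have [M M0 LM] := bounded_opP Lb.
have glb u : ((- ((M * `|v|) ^+ 2 / (2 * s)))%:E <= (EFin \o g) u)%E.
  rewrite lee_fin /g.
  have h : inner (L u) v <= M * `|v| * `|u|.
    apply: le_trans (inner_le _ _) _.
    by rewrite mulrAC; apply: ler_wpM2r.
  have h2 := sqr_ge0 `|F u|.
  have : 0 <= s / 2 * (`|u| - M * `|v| / s) ^+ 2.
    by rewrite mulr_ge0 ?sqr_ge0 // divr_ge0 // ltW.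
  have -> : s / 2 * (`|u| - M * `|v| / s) ^+ 2 = s / 2 * `|u| ^+ 2 -
    M * `|v| * `|u| + (M * `|v|) ^+ 2 / (2 * s) by field; rewrite gt_eqF.
  lra.
have [x xmin] : exists x, forall w, ((EFin \o g) x <= (EFin \o g) w)%E.
  have s8 : 0 < s / 8 by lra.
  apply: (strongly_convex_minimiser s8 glb glsc).

    by exists 0; rewrite ltry.
  move=> u w a b; rewrite !lee_fin => ga gb.
  suff : g (2^-1 *: (u + w)) <= (g u + g w) / 2 - s / 8 * `|u - w| ^+ 2 by lra.
  rewrite /g [F (_ *: _)]linearZ [L (_ *: _)]linearZ.
  rewrite [F (_ + _)]linearD [L (_ + _)]linearD !midpoint_sqr.
  rewrite innerZl innerDl.
  by have := sqr_ge0 `|F u - F w|; lra.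
exists x => u.
suff : inner (F x) (F u) + s * inner x u - inner (L u) v = 0.
  by move/subr0_eq.
apply: (@lin_coef_eq0 _ _ (2^-1 * `|F u| ^+ 2 + s / 2 * `|u| ^+ 2)) => t.
have := xmin (x + t *: u); rewrite lee_fin /g [F (_ + _)]linearD [L (_ + _)]linearD.
rewrite [F (_ *: _)]linearZ [L (_ *: _)]linearZ /= !normD_sqr.
rewrite !normZ_sqr innerDl !innerZr innerZl; lra.
Qed.

Lemma adjointP {U V : hilbertType R} (F : {linear U -> V}) (v : V) :
  bounded_op F -> forall u, inner (F u) v = inner u (adjoint F v).
Proof.
move=> Fb; rewrite /adjoint; case: xgetP => [w _ //|/= none].
have Ub : bounded_op (idfun : U -> U) by exists 1 => u; rewrite mul1r.
have Zb : bounded_op (\0 : U -> U) by exists 0 => u; rewrite mul0r normr0.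
have [x xP] := regularised_normal_equation v Zb Fb (ltr01).
by case: (none x) => u; rewrite -xP inner0l add0r mul1r innerC.
Qed.

End Adjoint.

Section NormalOperator.
Context {R : realType} {U V : hilbertType R} (F : {linear U -> V}).
Hypothesis Fb : bounded_op F.
Let A := adjoint F \o F.

Lemma adjoint_is_linear : linear (adjoint F).
Proof.
move=> a u w; apply: inner_ext => x.
by rewrite -adjointP // !(innerDr, innerZr) -!adjointP.
Qed.

Lemma adjointB u w : adjoint F (u - w) = adjoint F u - adjoint F w.
Proof.
by apply: inner_ext => x; rewrite -adjointP // !innerBr -!adjointP.
Qed.

Lemma adjointZ a u : adjoint F (a *: u) = a *: adjoint F u.
Proof.
by apply: inner_ext => x; rewrite -adjointP // !innerZr -!adjointP.
Qed.

Lemma normal_op_sym x w : inner (A x) w = inner x (A w).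
Proof. by rewrite -adjointP // innerC -adjointP // innerC. Qed.

Lemma inner_normal_op x : inner (A x) x = `|F x| ^+ 2.
Proof. by rewrite innerC -adjointP // inner_normE. Qed.

Lemma adjoint_bounded : bounded_op (adjoint F).
Proof.
have [M M0 FM] := bounded_opP Fb; exists M => v.
have [->|w0] := eqVneq (adjoint F v) 0; first by rewrite normr0 mulr_ge0 // ltW.
have W : 0 < `|adjoint F v| by rewrite normr_gt0.
rewrite -(ler_pM2l W) -expr2 -inner_normE -adjointP //.
apply: (le_trans (inner_le _ _)).
by rewrite mulrA; apply: ler_wpM2r => //; rewrite mulrC.
Qed.

Lemma normal_op_bounded : bounded_op A.
Proof.
have [M M0 FM] := bounded_opP Fb.
have [N N0 FN] := bounded_opP adjoint_bounded.
exists (N * M) => x; apply: (le_trans (FN _)).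
by rewrite -mulrA ler_pM2l.
Qed.

Lemma normal_op_linear : exists B : {linear U -> U}, B = A :> (U -> U).
Proof.
have lA : linear A by move=> a u w; rewrite /A /= linearP adjoint_is_linear.
pose m := GRing.isLinear.Build R U U _ A lA.
pose B : {linear U -> U} := HB.pack A m.
by exists B.
Qed.

Lemma normal_op_resolvent (z : U) (s : R) : 0 < s ->
  exists x, A x + s *: x = z.
Proof.
move=> s0.
have Ub : bounded_op (idfun : U -> U) by exists 1 => u; rewrite mul1r.
have [x xP] := regularised_normal_equation z Fb Ub s0.
exists x; apply: inner_ext => u; rewrite innerDr innerZr.
by rewrite -adjointP // -xP innerC (innerC u).
Qed.

End NormalOperator.

(** * Polynomials of a bounded symmetric operator *)

Section PolyOp.
Context {R : realType} {U : lmodType R} (A : {linear U -> U}).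
Implicit Types p q : {poly R}.

Lemma poly_op_widen p (n : nat) x : (size p <= n)%N ->
  poly_op p A x = \sum_(i < n) p`_i *: iter i A x.
Proof.
move=> pn; rewrite /poly_op (big_ord_widen n (fun i => p`_i *: iter i A x)) //.
rewrite big_mkcond /=; apply: eq_bigr => i _.
by case: ltnP => // pi; rewrite nth_default // scale0r.
Qed.

Lemma poly_opD p q x : poly_op (p + q) A x = poly_op p A x + poly_op q A x.
Proof.
pose n := maxn (size p) (size q).
rewrite !(@poly_op_widen _ n) ?leq_maxl ?leq_maxr ?size_polyD //.
by rewrite -big_split; apply: eq_bigr => i _; rewrite coefD scalerDl.
Qed.

Lemma poly_opZ a p x : poly_op (a *: p) A x = a *: poly_op p A x.
Proof.
rewrite !(@poly_op_widen _ (size p)) ?size_scale_leq // scaler_sumr.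
by apply: eq_bigr => i _; rewrite coefZ scalerA.
Qed.

Lemma poly_opC a x : poly_op a%:P A x = a *: x.
Proof. by rewrite (@poly_op_widen _ 1) ?size_polyC_leq1 // big_ord1 coefC. Qed.

Lemma poly_opB p q x : poly_op (p - q) A x = poly_op p A x - poly_op q A x.
Proof. by rewrite -[- q]scaleN1r poly_opD poly_opZ scaleN1r. Qed.

Lemma poly_op0 x : poly_op 0 A x = 0.
Proof. by rewrite /poly_op size_poly0 big_ord0. Qed.

Lemma poly_opMX p x : poly_op (p * 'X) A x = A (poly_op p A x).
Proof.
rewrite (@poly_op_widen _ (size p).+1); last first.
  by have := size_polyMleq p 'X; rewrite size_polyX addn2.
rewrite big_ord_recl coefMX /= scale0r add0r /poly_op linear_sum.
by apply: eq_bigr => i _; rewrite coefMX /= linearZ.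
Qed.

Lemma poly_op_arg p x : poly_op p A (A x) = A (poly_op p A x).
Proof.
rewrite /poly_op linear_sum; apply: eq_bigr => i _.
by rewrite -iterSr iterS linearZ.
Qed.

Lemma poly_opDr p x y : poly_op p A (x + y) = poly_op p A x + poly_op p A y.
Proof.
rewrite /poly_op -big_split; apply: eq_bigr => i _ /=; rewrite -scalerDr.
by congr (_ *: _); elim: (i : nat) => //= n ->; rewrite linearD.
Qed.

Lemma poly_opZr p a x : poly_op p A (a *: x) = a *: poly_op p A x.
Proof.
rewrite /poly_op scaler_sumr; apply: eq_bigr => i _ /=.
have -> : iter i A (a *: x) = a *: iter i A x.
  by elim: (i : nat) => //= n ->; rewrite linearZ.
by rewrite !scalerA mulrC.
Qed.

Lemma poly_opM p q x : poly_op (p * q) A x = poly_op p A (poly_op q A x).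
Proof.
elim/poly_ind: p => [|p c IH] in q x *; first by rewrite mul0r !poly_op0.
rewrite mulrDl -mulrA ['X * q]mulrC poly_opD IH poly_opMX mul_polyC poly_opZ.
by rewrite poly_opD poly_opMX poly_opC poly_op_arg.
Qed.

Lemma poly_opX x : poly_op 'X A x = A x.
Proof. by rewrite -['X]mul1r poly_opMX -polyC1 poly_opC scale1r. Qed.

End PolyOp.

Section BoundedSymmetric.
Context {R : realType} {U : hilbertType R} (A : {linear U -> U}).
Hypothesis A_bounded : bounded_op A.
Hypothesis A_sym : forall x y, inner (A x) y = inner x (A y).
Implicit Types p q : {poly R}.

Lemma poly_op_sym p x y : inner (poly_op p A x) y = inner x (poly_op p A y).
Proof.
elim/poly_ind: p => [|p c IH] in x y *.
  by rewrite !poly_op0 inner0l inner0r.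
by rewrite !poly_opD !poly_opMX !poly_opC innerDl innerDr A_sym IH innerZl innerZr
   poly_op_arg.
Qed.

Lemma poly_op_bounded p : bounded_op (poly_op p A).
Proof.
have [M M0 AM] := bounded_opP A_bounded.
elim/poly_ind: p => [|p c [N IH]].
  by exists 0 => x; rewrite poly_op0 normr0 mul0r.
exists (M * N + `|c|) => x; rewrite poly_opD poly_opMX poly_opC.
apply: (le_trans (ler_normD _ _)); rewrite mulrDl normrZ lerD2r -mulrA.
by apply: (le_trans (AM _)); rewrite ler_pM2l.
Qed.

(** The approximate point spectrum.  Unlike the spectrum it asks for lower
bounds only, so no inverse operators have to be constructed. *)
Definition approximate_spectrum : set R :=
  [set l | ~ exists2 c : R, 0 < c & forall x, c * `|x| <= `|A x - l *: x|].

Lemma approximate_spectrum_sub : approximate_spectrum `<=` spectrum A.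
Proof.
move=> l hl [B [/bounded_opP [M M0 BM] BA AB]]; apply: hl.
exists M^-1; rewrite ?invr_gt0 // => x; rewrite ler_pdivrMl //.
by rewrite -[X in `|X|]BA; exact: BM.
Qed.

Lemma approximate_spectrum_ge0 l : (forall x, 0 <= inner (A x) x) ->
  approximate_spectrum l -> 0 <= l.
Proof.
move=> Apos hl; rewrite leNgt; apply/negP => l0; apply: hl.
exists (- l) => [|x]; first lra.
have [->|x0] := eqVneq x 0; first by rewrite normr0 mulr0.
have X : 0 < `|x| by rewrite normr_gt0.
rewrite -(ler_pM2r X); apply: le_trans (inner_le _ _).
rewrite innerBl innerZl inner_normE.
by have := Apos x; lra.
Qed.

End BoundedSymmetric.

(** * Polynomials that are nonnegative on the spectrum *)

Section Positivity.
Context {R : realType} {U : hilbertType R} (A : {linear U -> U}).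
Hypothesis A_bounded : bounded_op A.
Hypothesis A_sym : forall x y, inner (A x) y = inner x (A y).
Implicit Types p q : {poly R}.

Let bounded_below p :=
  exists2 c : R, 0 < c & forall x, c * `|x| <= `|poly_op p A x|.

Let bounded_belowM p q :
  bounded_below p -> bounded_below q -> bounded_below (p * q).
Proof.
move=> [c c0 hc] [d d0 hd]; exists (c * d) => [|x]; first exact: mulr_gt0.
by rewrite poly_opM -mulrA; apply: le_trans (hc _); rewrite ler_pM2l.
Qed.

Let bounded_below_linear l :
  ~ approximate_spectrum A l -> bounded_below ('X - l%:P).
Proof.
by move=> /contrapT [c c0 hc]; exists c => // x; rewrite poly_opB poly_opX poly_opC.
Qed.

(* For real a and b, the operator (A - a)^2 + b^2 is at least b^2. *)
Let bounded_below_quadratic (a b : R) : b != 0 ->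
  bounded_below (('X - a%:P) ^+ 2 + (b ^+ 2)%:P).
Proof.
move=> b0; have B0 : 0 < b ^+ 2 by rewrite exprn_even_gt0.
exists (b ^+ 2) => // x.
have [->|x0] := eqVneq x 0; first by rewrite normr0 mulr0.
have X : 0 < `|x| by rewrite normr_gt0.
rewrite -(ler_pM2r X); apply: le_trans (inner_le _ _).
rewrite poly_opD poly_opC innerDl innerZl inner_normE expr2 poly_opM.
rewrite poly_op_sym // inner_normE -mulrA -expr2.
by have := sqr_ge0 `|poly_op ('X - a%:P) A x|; lra.
Qed.

(** A nonzero real polynomial is a product of linear factors X - l and of
quadratic factors (X - a)^2 + b^2, one for each pair of non-real roots. *)
Lemma poly_op_bounded_below p : p != 0 ->
  (forall l, root p l -> ~ approximate_spectrum A l) -> bounded_below p.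
Proof.
have [n] := ubnP (size p); elim: n => // n IH in p *.
rewrite ltnS => pn p0 rootp.
have [/eqP /size_poly1P [c c0 ->]|p1] := eqVneq (size p) 1%N.
  exists `|c|; first by rewrite normr_gt0.
  by move=> x; rewrite poly_opC normrZ.
have factor q p' : (1 < size q)%N -> p = p' * q -> bounded_below q -> bounded_below p.
  move=> q1 pE bq; have p'0 : p' != 0 by apply: contraNneq p0 => h; rewrite pE h mul0r.
  have q0 : q != 0 by rewrite -size_poly_gt0 ltnW.
  rewrite pE; apply: bounded_belowM => //; apply: IH => //.
    apply: leq_trans pn; rewrite pE size_mul //.
    by case: (size q) q1 => [|[|k]] // _; rewrite !addnS /= ltnS leq_addr.
  by move=> l pl; apply: rootp; rewrite pE rootM pl.
have : size (map_poly (real_complex R) p) != 1%N by rewrite size_map_poly.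
move=> /closed_rootP [[a b] rz].
have [b0|b0] := eqVneq b 0.
  have ra : root p a.
    by move: rz; rewrite b0 -[Complex a 0]/(real_complex R a) fmorph_root.
  have [p' pE] := factor_theorem p a ra.
  apply: (factor _ p' _ pE); first by rewrite size_XsubC.
  by apply: bounded_below_linear; exact: rootp.
pose q := ('X - a%:P) ^+ 2 + (b ^+ 2)%:P.
have sq : size q = 3%N.
  have s3 : size (('X - a%:P) ^+ 2) = 3%N by rewrite size_exp_XsubC.
  rewrite /q size_polyDl s3 //.
  by rewrite size_polyC; case: (_ == _).
have q0 : q != 0 by rewrite -size_poly_gt0 sq.
pose r := p %% q.
have sr : (size r <= 2)%N by have := ltn_modp p q; rewrite q0 sq.
have pE : p = (p %/ q) * q + r by rewrite -divp_eq.
(* The remainder r has degree at most one, real coefficients and the root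
a + i b with b != 0. *)
suff r0 : r = 0.
  apply: (factor q (p %/ q)); first by rewrite sq.
    by rewrite {1}pE r0 addr0.
  exact: bounded_below_quadratic.
have rE : r = r`_1 *: 'X + (r`_0)%:P.
  apply/polyP => i; rewrite coefD coefZ coefX coefC.
  case: i => [|[|i]]; rewrite ?mulr0 ?add0r ?mulr1 ?addr0 //=.
  by rewrite nth_default // (leq_trans sr).
have evq : (map_poly (real_complex R) q).[Complex a b] = 0.
  rewrite /q rmorphD rmorphXn rmorphB /= map_polyX !map_polyC /=.
  rewrite hornerD hornerC horner_exp hornerD hornerX hornerN hornerC.
  by apply/eqP; rewrite eq_complex /= expr2; apply/andP; split; apply/eqP; ring.
have evr : (map_poly (real_complex R) r).[Complex a b] = 0.
  move/rootP: rz; rewrite {1}pE rmorphD rmorphM /= hornerD hornerM evq.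
  by rewrite mulr0 add0r.
move: evr; rewrite {1}rE rmorphD /= -mul_polyC rmorphM /= map_polyX !map_polyC /=.
rewrite hornerD hornerC hornerM hornerX hornerC.
move/eqP; rewrite eq_complex /= => /andP[/eqP h1 /eqP h2].
have c1 : r`_1 = 0.
  by move/eqP: h2; rewrite mul0r !addr0 mulf_eq0 (negbTE b0) orbF => /eqP.
have c0 : r`_0 = 0 by move: h1; rewrite c1 !mul0r subr0 add0r.
by rewrite rE c0 c1 scale0r add0r.
Qed.

(** The lower bound m of the quadratic form of p(A) makes p(A) - m a positive
operator that is not bounded below, since a positive operator T with
c |x| <= |T x| satisfies <T x, x> >= c' |x|^2.  By
[poly_op_bounded_below], p - m has a root in the approximate spectrum. *)
Lemma quadratic_form_lower_bound p (x0 : U) : x0 != 0 -> (1 < size p)%N ->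
  exists2 l, approximate_spectrum A l &
    forall x, p.[l] * `|x| ^+ 2 <= inner (poly_op p A x) x.
Proof.
move=> x0n p1.
have [M M0 BM] := bounded_opP (poly_op_bounded A_bounded p).
pose S := [set inner (poly_op p A x) x / `|x| ^+ 2 | x in [set x | x != 0]].
have nsq (x : U) : x != 0 -> 0 < `|x| ^+ 2.
  by move=> xn; rewrite exprn_gt0 // normr_gt0.
have Slb : lbound S (- M).
  move=> _ [x /= xn <-]; rewrite ler_pdivlMr ?nsq //.
  apply: le_trans (inner_ge _ _); rewrite mulNr lerN2 expr2 mulrA.
  by apply: ler_wpM2r.
have Sinf : has_inf S.
  by split; [exists (inner (poly_op p A x0) x0 / `|x0| ^+ 2), x0|exists (- M)].
pose m := inf S.
have mP x : m * `|x| ^+ 2 <= inner (poly_op p A x) x.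
  have [->|xn] := eqVneq x 0.
    by rewrite normr0 expr0n mulr0 inner0r.
  rewrite -ler_pdivlMr ?nsq //; apply: ge_inf; first by exists (- M).
  by exists x.
have size_pm : (1 < size (p - m%:P)%R)%N.
  by rewrite size_polyDl // size_polyN (leq_ltn_trans (size_polyC_leq1 _) p1).
have pm0 : p - m%:P != 0 by rewrite -size_poly_gt0 ltnW.
have [[l sl rl]|none] :=
    pselect (exists2 l, approximate_spectrum A l & root (p - m%:P) l).
  exists l => // x; move: rl; rewrite /root hornerD hornerN hornerC subr_eq0.
  by move=> /eqP ->.
exfalso.
have [|c c0 hc] := poly_op_bounded_below pm0.
  by move=> l rl sl; apply: none; exists l.
pose T := poly_op (p - m%:P) A.
have [N N0 TN] := bounded_opP (poly_op_bounded A_bounded (p - m%:P)).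
have Tpos x : 0 <= inner (T x) x.
  by rewrite /T poly_opB poly_opC innerBl innerZl inner_normE subr_ge0.
have T_form x : c ^+ 2 / N * `|x| ^+ 2 <= inner (T x) x.
  (* The positivity of T at x - N^-1 T x gives |T x|^2 <= N <T x, x>. *)
  have := Tpos (x - N^-1 *: T x).
  rewrite {1}/T -[- (_ *: _)]scaleNr poly_opDr poly_opZr -/(T _) -/(T (T x)).
  rewrite !innerDl !innerDr !innerZl !innerZr.
  have -> : inner (T (T x)) x = `|T x| ^+ 2 by rewrite poly_op_sym // inner_normE.
  rewrite inner_normE.
  have h1 : inner (T (T x)) (T x) <= N * `|T x| ^+ 2.
    by apply: (le_trans (inner_le _ _)); rewrite expr2 mulrA ler_wpM2r.
  have h2 : c ^+ 2 * `|x| ^+ 2 <= `|T x| ^+ 2.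
    have h : c * `|x| <= `|T x| := hc x.
    by rewrite -exprMn ler_pXn2r ?nnegrE // mulr_ge0 // ltW.
  have h3 : N^-1 ^+ 2 * inner (T (T x)) (T x) <= N^-1 * `|T x| ^+ 2.
    rewrite expr2 -mulrA ler_pM2l ?invr_gt0 // ler_pdivrMl //.
  have h4 : N^-1 * (c ^+ 2 * `|x| ^+ 2) <= N^-1 * `|T x| ^+ 2.
    by rewrite ler_pM2l ?invr_gt0.
  by move: h3 h4; rewrite [c ^+ 2 / N]mulrC; lra.
suff : m + c ^+ 2 / N <= m.
  by rewrite gerDl leNgt divr_gt0 // exprn_gt0.
apply: lb_le_inf; first by case: Sinf.
move=> _ [x /= xn <-]; rewrite ler_pdivlMr ?nsq //.
have := T_form x; rewrite /T poly_opB poly_opC innerBl innerZl inner_normE; lra.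
Qed.

(** A polynomial of degree at least one takes the value of a lower bound of its
quadratic form on the approximate spectrum.  For a constant polynomial it
remains to see that the approximate spectrum is not empty, which is the
previous case for X. *)
Lemma poly_op_ge0 p : (forall l, approximate_spectrum A l -> 0 <= p.[l]) ->
  forall x, 0 <= inner (poly_op p A x) x.
Proof.
move=> pos x.
have [->|xn] := eqVneq x 0; first by rewrite inner0r.
have [p1|p1] := leqP (size p) 1.
  have X1 : (1 < size ('X : {poly R}))%N by rewrite size_polyX.
  have [l sl _] := quadratic_form_lower_bound xn X1.
  have := pos l sl; rewrite (size1_polyC p1) hornerC => h.
  by rewrite poly_opC innerZl inner_normE mulr_ge0 ?sqr_ge0.
have [l sl h] := quadratic_form_lower_bound xn p1.
by apply: le_trans (h x); rewrite mulr_ge0 ?sqr_ge0 // pos.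
Qed.

End Positivity.

(** * Inequalities for real powers *)

Section Powers.
Context {R : realType}.
Implicit Types a b r s t x X : R.

Lemma le_of_small_error a b c :
  (forall e, 0 < e -> e <= 1 -> a <= b + e * c) -> a <= b.
Proof.
move=> h; rewrite leNgt; apply/negP => ba.
pose d := `|c| + 1 + (a - b).
have c1 := ler_norm c; have c2 := normr_ge0 c.
have d0 : 0 < d by rewrite /d; lra.
have e0 : 0 < (a - b) / d by rewrite divr_gt0 // subr_gt0.
have e1 : (a - b) / d <= 1 by rewrite ler_pdivrMr // /d; lra.
have := h _ e0 e1; rewrite -lerBlDl mulrAC ler_pdivlMr // ler_pM2l ?subr_gt0 //.
by rewrite /d; lra.
Qed.

Lemma powRB_gt0 x r s : 0 < x -> x `^ (r - s) = x `^ r / x `^ s.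
Proof. by move=> x0; rewrite powRB //; apply/implyP => _; rewrite gt_eqF. Qed.

Lemma powR_le_tangent1 x r : 0 <= x -> 0 <= r -> r <= 1 ->
  x `^ r <= r * x + (1 - r).
Proof.
move=> x0; rewrite le_eqVlt => /predU1P[<- _|r0]; first by rewrite powRr0; lra.
rewrite le_eqVlt => /predU1P[->|r1]; first by rewrite powRr1 //; lra.
have := @conjugate_powR R (x `^ r) 1 r^-1 (1 - r)^-1 (powR_ge0 _ _) ler01.
rewrite !invr_gt0 !invrK mulr1 -powRrM mulfV ?gt_eqF // powRr1 // powR1.
rewrite mul1r mulrC; apply => //; lra.
Qed.

Lemma powR_le_tangent t s r : 0 <= t -> 0 < s -> 0 <= r -> r <= 1 ->
  t `^ r <= r * s `^ (r - 1) * t + (1 - r) * s `^ r.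
Proof.
move=> t0 s0 r0 r1.
have S : 0 < s `^ r by rewrite powR_gt0.
have -> : s `^ (r - 1) = s `^ r / s.
  by rewrite powRB_gt0 // powRr1 // ltW.
have {1}-> : t = t / s * s by rewrite divfK // gt_eqF.
have ts0 : 0 <= t / s by rewrite divr_ge0 // ltW.
rewrite powRM ?(ltW s0) //.
have := powR_le_tangent1 ts0 r0 r1; rewrite -(ler_pM2r S).
move=> /le_trans; apply; rewrite le_eqVlt; apply/orP; left; apply/eqP.
by field; rewrite gt_eqF.
Qed.

(** For positive a and b the infimum over s of the upper bounds is attained at
s = a / b; if a or b vanishes, it is approached as s tends to 0 or to
infinity. *)
Lemma powR_interpolation X a b r : 0 <= a -> 0 <= b -> 0 <= r -> r <= 1 ->
  (forall s, 0 < s -> X <= r * s `^ (r - 1) * a + (1 - r) * s `^ r * b) ->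
  X <= a `^ r * b `^ (1 - r).
Proof.
move=> a0 b0; rewrite le_eqVlt => /predU1P[<- _ /(_ 1 ltr01)|r0].
  by rewrite !powRr0 subr0 powRr1 // !mul0r add0r !mul1r.
rewrite le_eqVlt => /predU1P[->|r1 h].
  by move=> /(_ 1 ltr01); rewrite subrr !powRr0 !powRr1 // !mul0r addr0 !mul1r mulr1.
have [X0|X0] := leP X 0.
  by apply: (le_trans X0); rewrite mulr_ge0 ?powR_ge0.
move: a0; rewrite le_eqVlt => /predU1P[aE|a0].
  have B : 0 < b + 1 by lra.
  have S : 0 < X / (b + 1) by rewrite divr_gt0.
  have := h ((X / (b + 1)) `^ r^-1) (powR_gt0 _ S).
  rewrite -(powRrM _ r^-1 r) mulVf ?gt_eqF // (powRr1 (ltW S)) -aE mulr0 add0r.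
  rewrite -(ler_pM2r B).
  have -> : (1 - r) * (X / (b + 1)) * b * (b + 1) = (1 - r) * X * b.
    by field; rewrite gt_eqF.
  have : 0 <= r * X * b by rewrite !mulr_ge0 // ltW.
  by lra.
move: b0; rewrite le_eqVlt => /predU1P[bE|b0].
  have B : 0 < a + 1 by lra.
  have S : 0 < X / (a + 1) by rewrite divr_gt0.
  have := h ((X / (a + 1)) `^ (r - 1)^-1) (powR_gt0 _ S).
  have r1' : r - 1 != 0 by rewrite subr_eq0 lt_eqF.
  rewrite -(powRrM _ (r - 1)^-1 (r - 1)) mulVf // (powRr1 (ltW S)) -bE mulr0 addr0.
  rewrite -(ler_pM2r B).
  have -> : r * (X / (a + 1)) * a * (a + 1) = r * X * a.
    by field; rewrite gt_eqF.
  have : 0 <= (1 - r) * X * a by rewrite !mulr_ge0 // ltW // subr_gt0.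
  by lra.
have A : a != 0 by rewrite gt_eqF.
have B : b != 0 by rewrite gt_eqF.
have := h (a / b) (divr_gt0 a0 b0); move=> /le_trans; apply.
have -> : b `^ (1 - r) = b / b `^ r.
  by rewrite powRB_gt0 // powRr1 // ltW.
have -> : (a / b) `^ (r - 1) = (a / b) `^ r / (a / b).
  by rewrite powRB_gt0 ?divr_gt0 // powRr1 // divr_ge0 // ltW.
have -> : (a / b) `^ r = a `^ r / b `^ r.
  rewrite powRM ?invr_ge0 // ?(ltW a0) ?(ltW b0) //.
  by rewrite -(powR_inv1 (ltW b0)) powRAC powR_inv1 ?powR_ge0.
rewrite le_eqVlt; apply/orP; left; apply/eqP; field.
by rewrite A B gt_eqF // powR_gt0.
Qed.

Lemma powR_sqr a r : 0 <= a -> (a ^+ 2) `^ r = (a `^ r) ^+ 2.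
Proof. by move=> a0; rewrite !expr2 powRM. Qed.

End Powers.

(** * Source conditions as interpolation inequalities *)

Section SourceCondition.
Context {R : realType}.

(** If p_n converges to f on the spectrum and f^2 <= Q there, then
p_n^2 <= (1 + e) Q + e + e^2 there for large n, so that
|p_n(A) x|^2 <= <Q(A) x, x> + O(e) by positivity; and p_n(A) is symmetric.  If
no limit of such p_n(A) exists, the functional calculus is the zero map. *)
Lemma functional_calculus_inner {U : hilbertType R} (A : {linear U -> U})
    (f : R -> R) (Q : {poly R}) (om x : U) : bounded_op A ->
  (forall x y, inner (A x) y = inner x (A y)) ->
  (forall l, approximate_spectrum A l -> f l ^+ 2 <= Q.[l]) ->
  inner (functional_calculus A f om) x ^+ 2 <=
    `|om| ^+ 2 * inner (poly_op Q A x) x.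
Proof.
move=> Ab Asym fQ.
have Q0 : 0 <= inner (poly_op Q A x) x.
  by apply: poly_op_ge0 => // l sl; apply: le_trans (fQ l sl); exact: sqr_ge0.
rewrite /functional_calculus; case: xgetP => [B _ /= [p [pf pB]]|_ /=]; last first.
  by rewrite inner0l expr0n mulr_ge0 ?sqr_ge0.
set q := inner _ x in Q0 *.
apply: (@le_of_small_error _ _ _ (`|om| ^+ 2 * (3 * q + 6 * `|x| ^+ 2))) => e e0 e1.
have [n [pfn pBn]] : exists n,
    (forall t, spectrum A t -> `|(p n).[t] - f t| <= e) /\
    (forall x, `|poly_op (p n) A x - B x| <= e * `|x|).
  have := filterI (pf e e0) (pB e e0).
  by move=> [n _ /(_ n (leqnn n)) h]; exists n.
have pnx : `|poly_op (p n) A x| ^+ 2 <= (1 + e) * q + (e + e ^+ 2) * `|x| ^+ 2.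
  have : 0 <= inner (poly_op ((1 + e) *: Q + (e + e ^+ 2)%:P - p n * p n) A x) x.
    apply: poly_op_ge0 => // l sl.
    rewrite !hornerD hornerN hornerM hornerZ hornerC.
    have := pfn l (approximate_spectrum_sub sl); have := fQ l sl.
    move: (f l) (p n).[l] Q.[l] => y z Ql h1 zy.
    have h4 : (z - y) ^+ 2 <= e ^+ 2.
      by rewrite -[leLHS]real_normK ?num_real // ler_pXn2r ?nnegrE // ltW.
    have h5 := sqr_ge0 (z - y - e * y).
    (* Young's inequality for z = y + (z - y), with the weight that turns the
    error (z - y)^2 <= e^2 into e + e^2. *)
    have h6 : z ^+ 2 <= (1 + e) * y ^+ 2 + (1 + e^-1) * (z - y) ^+ 2.
      suff : 0 <= e^-1 * (z - y - e * y) ^+ 2.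
        have -> : e^-1 * (z - y - e * y) ^+ 2 =
          (1 + e) * y ^+ 2 + (1 + e^-1) * (z - y) ^+ 2 - z ^+ 2.
          by field; rewrite gt_eqF.
        by rewrite subr_ge0.
      by rewrite mulr_ge0 ?sqr_ge0 // invr_ge0 ltW.
    have h7 : (1 + e^-1) * (z - y) ^+ 2 <= (1 + e^-1) * e ^+ 2.
      by rewrite ler_pM2l // ltr_wpDr // invr_ge0 ltW.
    have h8 : (1 + e^-1) * e ^+ 2 = e + e ^+ 2 by field; rewrite gt_eqF.
    have h9 : (1 + e) * y ^+ 2 <= (1 + e) * Ql by rewrite ler_pM2l //; lra.
    by rewrite -expr2; lra.
  rewrite poly_opB !poly_opD poly_opM poly_opZ poly_opC innerBl innerDl !innerZl.
  by rewrite (poly_op_sym Asym (p n)) !inner_normE -/q; move: (q) => ?; lra.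
have W : 0 <= `|om| by [].
have Bom : `|inner (B om) x| <= `|om| * (`|poly_op (p n) A x| + e * `|x|).
  have -> : inner (B om) x = inner om (poly_op (p n) A x) -
      inner (poly_op (p n) A om - B om) x.
    by rewrite innerBl poly_op_sym //; ring.
  apply: (le_trans (ler_normB _ _)); rewrite mulrDr lerD ?cauchy_schwarz //.
  apply: (le_trans (cauchy_schwarz _ _)).
  by rewrite mulrA (mulrC _ e); apply: ler_wpM2r.
have h1 : inner (B om) x ^+ 2 <= (`|om| * (`|poly_op (p n) A x| + e * `|x|)) ^+ 2.
  rewrite -[leLHS]real_normK ?num_real // ler_pXn2r ?nnegrE //.
  by rewrite mulr_ge0 // addr_ge0 // mulr_ge0 // ltW.
apply: (le_trans h1); rewrite exprMn.
suff h : (`|poly_op (p n) A x| + e * `|x|) ^+ 2 <= q + e * (3 * q + 6 * `|x| ^+ 2).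
  have W2 : 0 <= `|om| ^+ 2 by rewrite sqr_ge0.
  by have := ler_wpM2l W2 h; rewrite mulrDr [e * (_ * _)]mulrCA.
move: pnx; move: `|poly_op (p n) A x| `|x| => a b pnx.
have h2 : (a + e * b) ^+ 2 <= (1 + e) * a ^+ 2 + (e + e ^+ 2) * b ^+ 2.
  have : 0 <= e * (a - b) ^+ 2 by rewrite mulr_ge0 ?sqr_ge0 // ltW.
  by nra.
have h3 : (1 + e) * a ^+ 2 <= (1 + e) * ((1 + e) * q + (e + e ^+ 2) * b ^+ 2).
  by rewrite ler_pM2l //; lra.
have b2 : 0 <= b ^+ 2 by rewrite sqr_ge0.
have e2 : e ^+ 2 <= e by rewrite expr2; nra.
have h4 : e ^+ 2 * q <= e * q by rewrite ler_wpM2r.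
have h5 : e ^+ 2 * b ^+ 2 <= e * b ^+ 2 by rewrite ler_wpM2r.
have h6 : e ^+ 3 * b ^+ 2 <= e * b ^+ 2.
  by rewrite ler_wpM2r // exprS; nra.
apply: (le_trans h2); apply: (le_trans (lerD h3 (lexx _))); nra.
Qed.

Context {U V : hilbertType R} (F : {linear U -> V}).
Hypothesis Fb : bounded_op F.
Variables (nu : R) (om : U).
Hypothesis nu_gt0 : 0 < nu.
Let A := adjoint F \o F.
Let xi := op_power A nu om.

(* As A is positive, its approximate spectrum lies in [0, +oo[. *)
Let op_power_inner (Q : {poly R}) (x : U) :
  (forall l, 0 <= l -> l `^ (2 * nu) <= Q.[l]) ->
  inner xi x ^+ 2 <= `|om| ^+ 2 * inner (poly_op Q A x) x.
Proof.
move=> hQ; have [B BA] := normal_op_linear Fb.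
have Bb : bounded_op B by rewrite BA; exact: normal_op_bounded.
have Bsym u w : inner (B u) w = inner u (B w) by rewrite BA; exact: normal_op_sym.
rewrite /xi /op_power /A -BA; apply: functional_calculus_inner => // l sl.
have l0 : 0 <= l.
  apply: approximate_spectrum_ge0 sl => u.
  by rewrite BA inner_normal_op // sqr_ge0.
by apply: le_trans (hQ l l0); rewrite mulrC powRrM powR_mulrn // powR_ge0.
Qed.

(** For 2 nu <= 1 the function t^(2 nu) is concave and lies below its tangents
c1 t + c0; these give <xi, x>^2 <= |om|^2 (c1 |F x|^2 + c0 |x|^2), to be
optimised over the point of tangency. *)
Lemma source_low (x : U) : nu <= 2^-1 ->
  `|inner xi x| <= `|om| * (`|F x| `^ (2 * nu) * `|x| `^ (1 - 2 * nu)).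
Proof.
move=> nu2; have n0 := nu_gt0; have r0 : 0 <= 2 * nu by lra.
have r1 : 2 * nu <= 1 by lra.
have W : 0 <= `|om| by [].
have h : inner xi x ^+ 2 <=
    (`|om| ^+ 2 * `|F x| ^+ 2) `^ (2 * nu) * (`|om| ^+ 2 * `|x| ^+ 2) `^ (1 - 2 * nu).
  apply: powR_interpolation => //; try by rewrite mulr_ge0 ?sqr_ge0.
  move=> s s0.
  pose Q := (2 * nu * s `^ (2 * nu - 1)) *: 'X + ((1 - 2 * nu) * s `^ (2 * nu))%:P.
  apply: (le_trans (op_power_inner (Q := Q) _ _)) => [l l0|].
    by rewrite /Q hornerD hornerZ hornerX hornerC; apply: powR_le_tangent.
  have [B BA] := normal_op_linear Fb.
  rewrite /Q /A -BA poly_opD poly_opZ poly_opX poly_opC innerDl !innerZl BA.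
  rewrite inner_normal_op // inner_normE le_eqVlt; apply/orP; left; apply/eqP.
  by ring.
rewrite -(@ler_pXn2r _ 2) ?nnegrE ?mulr_ge0 ?powR_ge0 //.
rewrite real_normK ?num_real //; apply: (le_trans h).
rewrite !(powRM _ (sqr_ge0 _) (sqr_ge0 _)) !powR_sqr //.
rewrite mulrACA -exprMn -powRD ?subrKC ?powRr1 //; last by rewrite oner_eq0.
by rewrite -!exprMn.
Qed.

(** For 2 nu >= 1, t^(2 nu) = t t^(2 nu - 1) lies below t times the tangents of
the concave function t^(2 nu - 1). *)
Lemma source_high (x : U) : 2^-1 <= nu -> nu <= 1 ->
  `|inner xi x| <= `|om| * (`|A x| `^ (2 * nu - 1) * `|F x| `^ (2 - 2 * nu)).
Proof.
move=> nu2 nu1; have n0 := nu_gt0; have r0 : 0 <= 2 * nu - 1 by lra.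
have r1 : 2 * nu - 1 <= 1 by lra.
have rE : 1 - (2 * nu - 1) = 2 - 2 * nu by ring.
have W : 0 <= `|om| by [].
have h : inner xi x ^+ 2 <=
    (`|om| ^+ 2 * `|A x| ^+ 2) `^ (2 * nu - 1) *
    (`|om| ^+ 2 * `|F x| ^+ 2) `^ (2 - 2 * nu).
  rewrite -rE; apply: powR_interpolation => //; try by rewrite mulr_ge0 ?sqr_ge0.
  move=> s s0.
  pose c1 := (2 * nu - 1) * s `^ (2 * nu - 1 - 1).
  pose c0 := (1 - (2 * nu - 1)) * s `^ (2 * nu - 1).
  pose Q : {poly R} := (c1 *: 'X + c0%:P) * 'X.
  apply: (le_trans (op_power_inner (Q := Q) _ _)) => [l l0|].
    rewrite /Q hornerM hornerD hornerZ hornerX hornerC.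
    rewrite -(@mulr_powRB1 _ l) //; last lra.
    by rewrite mulrC ler_wpM2r //; apply: powR_le_tangent.
  have [B BA] := normal_op_linear Fb.
  rewrite /Q /A -BA poly_opMX poly_opD poly_opZ poly_opX poly_opC BA.
  rewrite normal_op_sym // innerDl !innerZl inner_normE innerC inner_normal_op //.
  by rewrite le_eqVlt; apply/orP; left; apply/eqP; rewrite -/c1 -/c0; ring.
rewrite -(@ler_pXn2r _ 2) ?nnegrE ?mulr_ge0 ?powR_ge0 //.
rewrite real_normK ?num_real //; apply: (le_trans h).
rewrite !(powRM _ (sqr_ge0 _) (sqr_ge0 _)) !powR_sqr //.
rewrite mulrACA -exprMn -powRD; last first.
  by apply/implyP => /eqP; lra.
have -> : 2 * nu - 1 + (2 - 2 * nu) = 1 by ring.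
by rewrite powRr1 // -!exprMn.
Qed.

End SourceCondition.

(** * Absorption and rates *)

Section Absorption.
Context {R : realType}.
Implicit Types a b c m r x B : R.

(** Either x^rho dominates B x^th, or x^(rho - th) < 4 B. *)
Lemma powR_absorb x B th rho : 0 <= x -> 0 <= B -> 0 <= th -> th < rho ->
  B * x `^ th <=
    4^-1 * x `^ rho + 4 `^ (th / (rho - th)) * B `^ (rho / (rho - th)).
Proof.
move=> x0 B0 th0 thr.
have d0 : 0 < rho - th by rewrite subr_gt0.
have rho0 : rho != 0 by rewrite gt_eqF // (le_lt_trans th0).
have [h|h] := leP (B * x `^ th) (4^-1 * x `^ rho).
  by apply: (le_trans h); rewrite lerDl mulr_ge0 ?powR_ge0.
have [xE|xn] := eqVneq x 0.
  move: h; rewrite xE (@powR0 _ rho) ?mulr0 ?gt_eqF //; last exact: le_lt_trans thr.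
  move: th0; rewrite le_eqVlt => /predU1P[<- _|th0].
    by rewrite mul0r !powRr0 subr0 mulfV // powRr1 // !mulr1 add0r mul1r.
  by rewrite powR0 ?gt_eqF // mulr0 ltxx.
have xp : 0 < x by rewrite lt_neqAle eq_sym xn.
have xth : 0 < x `^ th by rewrite powR_gt0.
have xd : x `^ (rho - th) <= 4 * B.
  rewrite powRB_gt0 // ler_pdivrMr //; lra.
have x_le : x `^ th <= (4 * B) `^ (th / (rho - th)).
  have -> : x `^ th = (x `^ (rho - th)) `^ (th / (rho - th)).
    by rewrite -powRrM; congr powR; field; rewrite gt_eqF.
  apply: ge0_ler_powR; rewrite ?nnegrE ?powR_ge0 //; last by rewrite mulr_ge0.
  by rewrite divr_ge0 // ltW.
have Bp : 0 < B.
  rewrite lt_neqAle B0 andbT; apply/eqP => BE.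
  by move: h; rewrite -BE mul0r ltNge mulr_ge0 ?powR_ge0.
have := ler_wpM2l B0 x_le; rewrite powRM //.
have -> : rho / (rho - th) = 1 + th / (rho - th) by field; rewrite gt_eqF.
rewrite (powRD (r := 1)) ?powRr1 //; last by apply/implyP => _; rewrite gt_eqF.
move=> h1; apply: (le_trans h1); rewrite mulrCA lerDr.
by rewrite mulr_ge0 ?powR_ge0.
Qed.

(** For alpha ~ delta^a the first term is of order delta^(2 - a), and absorbing
D^r turns the second one into alpha^(m / (1 - r)); the hypotheses on a and b say
that both orders are b. *)
Lemma rate_of_absorption K c c' m r a b : 0 < c -> c <= c' -> 0 <= K ->
  0 <= m -> 0 <= r -> r < 1 -> b = 2 - a -> a * (m / (1 - r)) = b ->
  exists2 C, 0 < C & forall delta alpha D : R, 0 < delta ->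
    c * delta `^ a <= alpha -> alpha <= c' * delta `^ a -> 0 <= D ->
    D <= delta ^+ 2 / alpha + K * alpha `^ m * D `^ r -> D <= C * delta `^ b.
Proof.
move=> c0 cc' K0 m0 r0 r1 bE amE.
have r1' : 0 < 1 - r by rewrite subr_gt0.
have c'0 : 0 <= c' by apply: le_trans cc'; exact: ltW.
pose k := m / (1 - r).
have k0 : 0 <= k by rewrite divr_ge0 // ltW.
pose C1 := 4 `^ (r / (1 - r)) * K `^ (1 / (1 - r)) * c' `^ k.
have C10 : 0 <= C1 by rewrite !mulr_ge0 ?powR_ge0.
exists (2 * (c^-1 + C1)).
  by rewrite mulr_gt0 // ltr_wpDr // invr_gt0.
move=> d al D d0 al1 al2 D0 DE.
have da : 0 < d `^ a by rewrite powR_gt0.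
have al0 : 0 < al by apply: lt_le_trans al1; rewrite mulr_gt0.
have t1 : d ^+ 2 / al <= c^-1 * d `^ b.
  rewrite ler_pdivrMr // bE powRB_gt0 // -(powR_mulrn 2 (ltW d0)).
  have -> : c^-1 * (d `^ 2 / d `^ a) * al = d `^ 2 * (al / (c * d `^ a)).
    by field; rewrite !gt_eqF.
  by rewrite ler_peMr ?powR_ge0 // ler_pdivlMr ?mul1r ?mulr_gt0.
have Kal : 0 <= K * al `^ m by rewrite mulr_ge0 ?powR_ge0.
have := powR_absorb D0 Kal r0 r1; rewrite (powRr1 D0) powRM ?powR_ge0 //.
rewrite -powRrM mul1r => t2.
have t3 : al `^ (m / (1 - r)) <= c' `^ k * d `^ b.
  rewrite -amE -/k (powRrM d) -(powRM _ c'0 (ltW da)).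
  by apply: ge0_ler_powR; rewrite ?nnegrE // ?(ltW al0) // mulr_ge0 // ltW.
have t4 : 4 `^ (r / (1 - r)) * (K `^ (1 - r)^-1 * al `^ (m / (1 - r))) <= C1 * d `^ b.
  rewrite /C1 div1r -!mulrA ler_wpM2l ?powR_ge0 // ler_wpM2l ?powR_ge0 //.
move: DE t1 t2 t4 (mulr_ge0 C10 (powR_ge0 d b)) (powR_ge0 d b).
move: (C1) (d ^+ 2 / al) (K * al `^ m * D `^ r) => C2 e1 e2.
by move: (4 `^ _ * _) => e3; nra.
Qed.

End Absorption.

(** * Tikhonov minimisers *)

Section Tikhonov.
Context {R : realType} {U V : hilbertType R} (F : {linear U -> V}).
Variable J : U -> \bar R.
Hypothesis J_ge0 : forall u, (0 <= J u)%E.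

Lemma lty_real (x : \bar R) : (0 <= x)%E -> (x < +oo)%E ->
  exists2 j : R, 0 <= j & x = j%:E.
Proof. by case: x => [j| |] // h _; exists j. Qed.

Lemma tikhonov_finite (alpha : R) v u u0 : 0 < alpha -> (J u0 < +oo)%E ->
  tikhonov_minimiser F J alpha v u -> exists2 j : R, 0 <= j & J u = j%:E.
Proof.
move=> al0 Ju0 min; apply: lty_real => //.
have [j0 _ j0E] := lty_real (J_ge0 u0) Ju0.
have := min u0; rewrite /tikhonov j0E -EFinM -EFinD.
by move: (J_ge0 u); case: (J u) => [j| |] // _; rewrite ?ltry // gt0_muley ?lte_fin.
Qed.

(** The minimiser is compared with the points u + t (w - u) of the segment
towards w; convexity bounds J there, and t tends to 0. *)
Lemma tikhonov_optimality (alpha : R) v u u0 w : convex_functional J ->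
  0 < alpha -> (J u0 < +oo)%E -> tikhonov_minimiser F J alpha v u ->
  (J u + (alpha^-1 * inner (v - F u) (F (w - u)))%:E <= J w)%E.
Proof.
move=> Jc al0 Ju0 min.
have [j _ jE] := tikhonov_finite al0 Ju0 min.
have [Jw|] := ltP (J w) +oo%E; last by move=> /(le_trans _); apply; rewrite leey.
have [b _ bE] := lty_real (J_ge0 w) Jw.
rewrite jE bE lee_fin.
set i := inner _ _.
suff : i - alpha * (b - j) <= 0.
  move=> h; have : alpha^-1 * i <= b - j by rewrite ler_pdivrMl // -subr_le0.
  by lra.
apply: (@le_of_small_error _ _ _ (4^-1 * `|F (w - u)| ^+ 2)) => e e0 e1.
rewrite add0r.
have t0 : 0 < e / 2 by lra.
have t1 : e / 2 < 1 by lra.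
have := Jc w u _ t0 t1; rewrite jE bE.
set x := _ + _ => Jx.
have Jxf : (J x < +oo)%E by apply: le_lt_trans Jx _; rewrite -!EFinM -EFinD ltry.
have [k _ kE] := lty_real (J_ge0 x) Jxf.
move: Jx; rewrite kE -!EFinM -EFinD lee_fin => k_le.
have := min x; rewrite /tikhonov jE kE -!EFinM -!EFinD lee_fin.
have -> : F x - v = (F u - v) + (e / 2) *: F (w - u).
  have -> : x = u + (e / 2) *: (w - u).
    by rewrite /x scalerBl scale1r scalerBr addrCA.
  by rewrite [F (_ + _)]linearD [F (_ *: _)]linearZ addrAC.
rewrite (normD_sqr (F u - v)) normZ_sqr innerZr -[F u - v]opprB innerNl -/i normrN => h.
rewrite -(ler_pM2l t0).
have : alpha * k <= alpha * (e / 2 * b + (1 - e / 2) * j) by rewrite ler_pM2l.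
move: h; move: (i) (`|v - F u| ^+ 2) (`|F (w - u)| ^+ 2); clear => *; lra.
Qed.

Lemma tikhonov_subgradientP (alpha : R) v u u0 : bounded_op F ->
  convex_functional J -> 0 < alpha -> (J u0 < +oo)%E ->
  tikhonov_minimiser F J alpha v u ->
  subdifferential J u (tikhonov_subgradient F alpha v u).
Proof.
move=> Fb Jc al0 Ju0 min; split.
  by have [j _ ->] := tikhonov_finite al0 Ju0 min; rewrite ltry.
move=> w; rewrite /tikhonov_subgradient innerZl innerC -adjointP // innerC.
exact: tikhonov_optimality Ju0 min.
Qed.

Lemma coercive_sublevel_bounded (K : R) : coercive J ->
  exists2 rho : R, 0 < rho & forall u, (J u <= K%:E)%E -> `|u| <= rho.
Proof.
move=> Jco; have [r hr] := Jco (K + 1).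
exists (`|r| + 1) => [|u uK]; first by rewrite ltr_pwDr.
rewrite leNgt; apply/negP => ru.
have : r <= `|u| by have := ler_norm r; lra.
by move=> /hr /le_trans /(_ uK); rewrite lee_fin; lra.
Qed.

End Tikhonov.

(** * Convergence rates for low order source conditions *)

Section Rates.
Context {R : realType} {U V : hilbertType R} (F : {linear U -> V}).
Variable J : U -> \bar R.
Hypothesis Fb : bounded_op F.
Hypothesis J_ge0 : forall u, (0 <= J u)%E.
Hypothesis J_coercive : coercive J.
Variables (udag xi : U).
Hypothesis xi_sub : subdifferential J udag xi.

(** The comparison of u with u^dag in the Tikhonov functional, combined with
|F (u - u^dag)|^2 <= 2 |F u - v|^2 + 2 |v - F u^dag|^2. *)
Lemma tikhonov_bregman_estimate (alpha delta : R) v u : 0 < alpha ->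
  `|v - F udag| <= delta -> tikhonov_minimiser F J alpha v u ->
  exists j j0 D : R, [/\ J u = j%:E, J udag = j0%:E,
    bregman J xi u udag = D%:E & 0 <= D] /\
   (alpha * j <= 2^-1 * delta ^+ 2 + alpha * j0 /\
    alpha * D + 4^-1 * `|F (u - udag)| ^+ 2 <=
      delta ^+ 2 - alpha * inner xi (u - udag)).
Proof.
move=> al0 vd min; have [Ju0 sub] := xi_sub.
have [j _ jE] := tikhonov_finite J_ge0 al0 Ju0 min.
have [j0 _ j0E] := lty_real (J_ge0 udag) Ju0.
exists j, j0, (j - j0 - inner xi (u - udag)).
have d0 : 0 <= delta by apply: le_trans vd.
have vd2 : `|F udag - v| ^+ 2 <= delta ^+ 2.
  by rewrite ler_pXn2r ?nnegrE // distrC.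
have := min udag; rewrite /tikhonov jE j0E -!EFinM -!EFinD lee_fin => h.
have h1 : alpha * j <= 2^-1 * delta ^+ 2 + alpha * j0 - 2^-1 * `|F u - v| ^+ 2.
  by lra.
split; [split => //|split].
- by rewrite /bregman jE j0E.
- by have := sub u; rewrite jE j0E lee_fin; lra.
- by have := sqr_ge0 `|F u - v|; lra.
have h2 : `|F (u - udag)| ^+ 2 <= 2 * (`|F u - v| ^+ 2 + delta ^+ 2).
  have -> : F (u - udag) = (F u - v) - (F udag - v).
    by rewrite linearB opprB addrA subrK.
  have := parallelogram (F u - v) (F udag - v).
  by have := sqr_ge0 `|(F u - v) + (F udag - v)|; lra.
by lra.
Qed.

(** The comparison with u^dag gives J u <= J u^dag + delta^2 / (2 alpha), which
is bounded for a <= 2, and J is coercive. *)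
Lemma tikhonov_minimisers_bounded (c a : R) : 0 < c -> a <= 2 ->
  exists2 rho, 0 < rho & forall (delta alpha : R) v u, 0 < delta -> delta <= 1 ->
    c * delta `^ a <= alpha -> `|v - F udag| <= delta ->
    tikhonov_minimiser F J alpha v u -> `|u| <= rho.
Proof.
move=> c0 a2; have [Ju0 _] := xi_sub.
have [j0 _ j0E] := lty_real (J_ge0 udag) Ju0.
have [rho rho0 hrho] := coercive_sublevel_bounded (j0 + c^-1) J_coercive.
exists rho => // d al v u d0 d1 al1 vd min; apply: hrho.
have da : 0 < d `^ a by rewrite powR_gt0.
have al0 : 0 < al by apply: lt_le_trans al1; rewrite mulr_gt0.
have [j [j0' [D [[jE j0E' _ _] [jle _]]]]] := tikhonov_bregman_estimate al0 vd min.
move: j0E'; rewrite j0E => -[j00']; rewrite -j00' in jle.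
rewrite jE lee_fin -(ler_pM2l al0); apply: (le_trans jle).
have d2 : d ^+ 2 <= d `^ a.
  by rewrite -(powR_mulrn 2 (ltW d0)); apply: ger_powR; rewrite // d0 d1.
have h : d `^ a <= c^-1 * al by rewrite ler_pdivlMl.
have := sqr_ge0 d; rewrite mulrDr (mulrC al c^-1).
by move: (c^-1 * al) h d2 => ca; lra.
Qed.

Variables (nu : R) (om : U).
Hypothesis nu_gt0 : 0 < nu.
Hypothesis source : xi = op_power (adjoint F \o F) nu om.

(** By [source_low], alpha D + f^2 / 4 <= delta^2 + alpha K D^s f^(2 nu) for
f = |F (u - u^dag)|, from which first f and then D^(s / (1 - nu)) is absorbed.
The parameter s measures how much of |u - u^dag|^(1 - 2 nu) is controlled by
the Bregman distance: s = 0 if it is only known to be bounded, and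
s = (1 - 2 nu) / p under local p-convexity. *)
Lemma rate_low_smoothness (s a b : R) : nu <= 2^-1 -> 0 <= s -> s < 1 - nu ->
  b = 2 - a -> 0 <= b -> a * (nu / (1 - nu) / (1 - s / (1 - nu))) = b ->
  (forall rho, 0 < rho -> exists2 K, 0 <= K & forall u (D : R),
     `|u - udag| <= rho -> bregman J xi u udag = D%:E -> 0 <= D ->
     `|u - udag| `^ (1 - 2 * nu) <= K * D `^ s) ->
  convergence_rate F J (F udag) a b (fun _ _ u => bregman J xi u udag).
Proof.
move=> nu2 s0 s1 bE b0 abE hK c c' c0 cc'.
have nu0 := nu_gt0; have a2 : a <= 2 by lra.
have nu1 : 0 < 1 - nu by lra.
have [rho rho0 hrho] := tikhonov_minimisers_bounded c0 a2.
have rho'0 : 0 < rho + `|udag| by rewrite ltr_pwDl.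
have [K K0 KP] := hK _ rho'0.
pose K1 := 4 `^ ((2 * nu) / (2 - 2 * nu)) * (`|om| * K) `^ (1 - nu)^-1.
have m0 : 0 <= nu / (1 - nu) by rewrite divr_ge0 // ltW.
have r0 : 0 <= s / (1 - nu) by rewrite divr_ge0 // ltW.
have r1 : s / (1 - nu) < 1 by rewrite ltr_pdivrMr // mul1r.
have K10 : 0 <= K1 by rewrite mulr_ge0 ?powR_ge0.
have [C C0 CP] := rate_of_absorption c0 cc' K10 m0 r0 r1 bE abE.
exists 1, C; split => // d al v u d0 d1 al1 al2 vd min.
have da : 0 < d `^ a by rewrite powR_gt0.
have al0 : 0 < al by apply: lt_le_trans al1; rewrite mulr_gt0.
have [j [j0 [D [[_ _ DE D0] [_ main]]]]] := tikhonov_bregman_estimate al0 vd min.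
rewrite DE lee_fin; apply: (CP d al D) => //.
have u_near : `|u - udag| <= rho + `|udag|.
  by apply: (le_trans (ler_normB _ _)); rewrite lerD2r; exact: (hrho d al v u).
set f := `|F (u - udag)| in main.
have f0 : 0 <= f by rewrite normr_ge0.
pose B := al * (`|om| * K) * D `^ s.
have omK : 0 <= `|om| * K by rewrite mulr_ge0.
have B0 : 0 <= B by rewrite !mulr_ge0 ?powR_ge0 // ltW.
have inner_xi : - (al * inner xi (u - udag)) <= B * f `^ (2 * nu).
  have h := source_low Fb om nu_gt0 (u - udag) nu2.
  rewrite -source -/f in h.
  have h2 := KP _ _ u_near DE D0.
  have h3 : - inner xi (u - udag) <= `|om| * (f `^ (2 * nu) * (K * D `^ s)).
    apply: le_trans (_ : `|inner xi (u - udag)| <= _).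
      by rewrite -normrN ler_norm.
    by apply: (le_trans h); rewrite ler_wpM2l // ler_wpM2l ?powR_ge0.
  rewrite -mulrN /B.
  have -> : al * (`|om| * K) * D `^ s * f `^ (2 * nu) =
    al * (`|om| * (f `^ (2 * nu) * (K * D `^ s))) by ring.
  by rewrite ler_pM2l.
have th0 : 0 <= 2 * nu by lra.
have th2 : 2 * nu < 2 by lra.
have := powR_absorb f0 B0 th0 th2.
rewrite (powR_mulrn 2 f0).
have -> : 2 / (2 - 2 * nu) = (1 - nu)^-1.
  by field; apply/andP; split; lra.
have -> : B `^ (1 - nu)^-1 =
    (`|om| * K) `^ (1 - nu)^-1 * (al * (al `^ (nu / (1 - nu)) * D `^ (s / (1 - nu)))).
  rewrite /B powRM ?powR_ge0 ?mulr_ge0 // ?(ltW al0) // powRM // ?(ltW al0) //.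
  rewrite -powRrM.
  have -> : al `^ (1 - nu)^-1 = al * al `^ (nu / (1 - nu)).
    have kE : (1 - nu)^-1 = 1 + nu / (1 - nu) by field; lra.
    rewrite [in LHS]kE (powRD (r := 1)) ?(powRr1 (ltW al0)) //.
    by rewrite (gt_eqF al0); apply/implyP.
  by ring.
move=> h; rewrite -(ler_pM2l al0).
have -> : al * (d ^+ 2 / al + K1 * al `^ (nu / (1 - nu)) * D `^ (s / (1 - nu))) =
  d ^+ 2 + 4 `^ (2 * nu / (2 - 2 * nu)) * ((`|om| * K) `^ (1 - nu)^-1 *
   (al * (al `^ (nu / (1 - nu)) * D `^ (s / (1 - nu))))).
  by rewrite /K1; field; rewrite gt_eqF.
move: h main inner_xi.
move: (4 `^ _ * (_ * _)) (B * f `^ (2 * nu)) (al * inner xi (u - udag)) (f ^+ 2).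
by move=> *; lra.
Qed.

End Rates.

(** * Convergence rates for high order source conditions *)

Section HighOrder.
Context {R : realType} {U V : hilbertType R} (F : {linear U -> V}).
Hypothesis Fb : bounded_op F.
Variables (xi : U) (nu : R) (om : U).
Hypothesis nu_gt0 : 0 < nu.
Hypothesis nu_ge : 2^-1 <= nu.
Hypothesis nu_le1 : nu <= 1.
Hypothesis source : xi = op_power (adjoint F \o F) nu om.
Let A := adjoint F \o F.

Lemma source_high_inner (x : U) :
  inner xi x <= `|om| * (`|A x| `^ (2 * nu - 1) * `|F x| `^ (2 - 2 * nu)).
Proof.
rewrite source; apply: le_trans (ler_norm _) _.
exact: (source_high Fb om nu_gt0 x nu_ge nu_le1).
Qed.

Lemma norm_normal_resolvent (s : R) (x z : U) : 0 < s -> A x + s *: x = z ->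
  `|A x| <= `|z|.
Proof.
move=> s0 <-; rewrite -(@ler_pXn2r _ 2) ?nnegrE //.
rewrite (normD_sqr (A x)) innerZr inner_normal_op // -addrA lerDl.
by rewrite addr_ge0 ?sqr_ge0 // mulr_ge0 // mulr_ge0 ?sqr_ge0 // ltW.
Qed.

Lemma norm_resolvent_adjoint (s : R) (x : U) (zeta : V) : 0 < s ->
  A x + s *: x = adjoint F zeta -> `|F x| <= `|zeta|.
Proof.
move=> s0 xE.
have [->|Fx0] := eqVneq (F x) 0; first by rewrite normr0.
have Fx : 0 < `|F x| by rewrite normr_gt0.
rewrite -(ler_pM2r Fx) -expr2 -inner_normal_op //.
apply: le_trans (inner_le zeta (F x)).
rewrite innerC [leRHS]innerC adjointP // -xE innerDr innerZr lerDl.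
by rewrite inner_normE mulr_ge0 ?sqr_ge0 // ltW.
Qed.

(** For y = (A + s)^-1 xi, the equality <xi, y> = |F y|^2 + s |y|^2 and the
source condition bound s |y|^2 independently of s. *)
Lemma regularised_source_small : exists2 K, 0 <= K &
  forall (s : R) (y : U), 0 < s -> A y + s *: y = xi -> `|s *: y| ^+ 2 <= s * K.
Proof.
have nu0 := nu_gt0; have nu1 := nu_ge; have nu2 := nu_le1.
pose B := `|om| * `|xi| `^ (2 * nu - 1).
have B0 : 0 <= B by rewrite mulr_ge0 ?powR_ge0.
have th0 : 0 <= 2 - 2 * nu by lra.
have th2 : 2 - 2 * nu < 2 by lra.
exists (4 `^ ((2 - 2 * nu) / (2 - (2 - 2 * nu))) * B `^ (2 / (2 - (2 - 2 * nu)))).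
  by rewrite mulr_ge0 ?powR_ge0.
move=> s y s0 yE.
rewrite normZ_sqr expr2 -mulrA ler_pM2l //.
have := powR_absorb (normr_ge0 (F y)) B0 th0 th2.
rewrite (powR_mulrn 2) //.
have h1 : inner xi y = `|F y| ^+ 2 + s * `|y| ^+ 2.
  by rewrite -yE innerDl innerZl inner_normal_op // inner_normE.
have h2 : inner xi y <= B * `|F y| `^ (2 - 2 * nu).
  apply: le_trans (source_high_inner y) _; rewrite /B -mulrA ler_wpM2l //.
  apply: ler_wpM2r; first exact: powR_ge0.
  apply: ge0_ler_powR; rewrite ?nnegrE //; first lra.
  exact: norm_normal_resolvent yE.
move: h2 (sqr_ge0 `|F y|); rewrite h1.
move: (B * _) (4 `^ _ * _) (`|F y| ^+ 2) (s * _) => *; lra.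
Qed.

(** Here F y stands for an element eta with F^* eta = xi, to which it tends
formally as s tends to 0.  The bound is [source_high] for
x = (A + s)^-1 F^* zeta, since <zeta, F y> = <x, xi>. *)
Lemma inner_regularised_source (s : R) (y : U) (zeta : V) : 0 < s ->
  A y + s *: y = xi ->
  `|inner zeta (F y)| <=
    `|om| * (`|adjoint F zeta| `^ (2 * nu - 1) * `|zeta| `^ (2 - 2 * nu)).
Proof.
have nu0 := nu_gt0; have nu1 := nu_ge; have nu2 := nu_le1.
move=> s0 yE; have [x xE] := normal_op_resolvent Fb (adjoint F zeta) s0.
have -> : inner zeta (F y) = inner xi x.
  rewrite innerC adjointP // -xE -yE innerDr innerDl innerZr innerZl.
  by rewrite normal_op_sym // (innerC y).
have h := source_high Fb om nu_gt0 x nu_ge nu_le1.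
rewrite -source in h; apply: (le_trans h); rewrite ler_wpM2l //.
apply: ler_pM; rewrite ?powR_ge0 //.
  apply: ge0_ler_powR; rewrite ?nnegrE //; first lra.
  exact: norm_normal_resolvent xE.
apply: ge0_ler_powR; rewrite ?nnegrE //; first lra.
exact: norm_resolvent_adjoint xE.
Qed.

(** With zeta = g - F y for g = (v - F u) / alpha, the difference of the
subgradients is F^* zeta up to the term s y, and testing with zeta gives
D + alpha |zeta|^2 = <zeta, v - F u^dag> - alpha <zeta, F y> up to O(|s y|). *)
Lemma bregman_sym_estimate : exists2 K, 0 <= K &
  forall (alpha delta : R) (v : V) (u udag : U), 0 < alpha ->
  `|v - F udag| <= delta ->
  forall xia D, xia = tikhonov_subgradient F alpha v u ->
  D = bregman_sym xia xi u udag ->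
  D <= delta ^+ 2 / alpha + alpha * (K * `|xia - xi| `^ ((2 * nu - 1) / nu)).
Proof.
have nu0 := nu_gt0; have nu1 := nu_ge; have nu2 := nu_le1.
have [K0 K00 hK0] := regularised_source_small.
have th0 : 0 <= 2 - 2 * nu by lra.
have th2 : 2 - 2 * nu < 2 by lra.
have k0 : 0 <= (2 * nu - 1) / nu by rewrite divr_ge0 //; lra.
pose K1 := 4 `^ ((2 - 2 * nu) / (2 - (2 - 2 * nu))) * `|om| `^ nu^-1.
exists (2 * K1 * 2 `^ ((2 * nu - 1) / nu)).
  by rewrite !mulr_ge0 ?powR_ge0.
move=> al d v u udag al0 vd xia D xia_def; rewrite /bregman_sym => DE.
set N := `|xia - xi|.
have N0 : 0 <= N by rewrite normr_ge0.
have [D0|D0] := leP D 0.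
  apply: (le_trans D0); rewrite addr_ge0 //; first by rewrite divr_ge0 ?sqr_ge0 // ltW.
  by rewrite !mulr_ge0 ?powR_ge0 // ltW.
have DN : D <= N * `|u - udag| by rewrite DE inner_le.
have Np : 0 < N.
  by rewrite lt_neqAle N0 andbT; apply/eqP => NE; move: DN; rewrite -NE mul0r leNgt D0.
have ep : 0 < `|u - udag|.
  rewrite lt_neqAle normr_ge0 andbT; apply/eqP => NE.
  by move: DN; rewrite -NE mulr0 leNgt D0.
(* The regularisation s is chosen such that the error s y is dominated by the
quantities to be estimated. *)
pose sg := Num.min N (D / (2 * `|u - udag|)).
have sg0 : 0 < sg by rewrite lt_min Np divr_gt0 // mulr_gt0.
have K01 : 0 < K0 + 1 by rewrite ltr_wpDl.
pose s := sg ^+ 2 / (K0 + 1).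
have s0 : 0 < s by rewrite divr_gt0 // exprn_gt0.
have [y yE] := normal_op_resolvent Fb xi s0.
have sy : `|s *: y| <= sg.
  rewrite -(@ler_pXn2r _ 2) ?nnegrE // ?(ltW sg0) //.
  apply: (le_trans (hK0 s y s0 yE)); rewrite /s mulrAC ler_pdivrMr //.
  by rewrite ler_pM2l ?exprn_gt0 // lerDl.
have sy1 : `|s *: y| <= N by apply: (le_trans sy); rewrite ge_min lexx.
have sy2 : - inner (s *: y) (u - udag) <= D / 2.
  rewrite -innerNl; apply: (le_trans (inner_le _ _)); rewrite normrN.
  have : `|s *: y| <= D / (2 * `|u - udag|).
    by apply: (le_trans sy); rewrite ge_min lexx orbT.
  rewrite -(ler_pM2r ep) => /le_trans; apply.
  by rewrite le_eqVlt; apply/orP; left; apply/eqP; field; rewrite gt_eqF.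
pose g := al^-1 *: (v - F u).
pose zeta := g - F y.
have xiaE : xia = adjoint F g by rewrite xia_def /g adjointZ.
have adj_zeta : adjoint F zeta = xia - xi + s *: y.
  rewrite /zeta adjointB // -xiaE -yE opprD addrA subrK.
  by [].
set h := `|zeta|.
have h0 : 0 <= h by rewrite normr_ge0.
have identity : D + inner (s *: y) (u - udag) + al * h ^+ 2 =
    inner zeta (v - F udag) - al * inner zeta (F y).
  have -> : D + inner (s *: y) (u - udag) = inner zeta (F (u - udag)).
    by rewrite DE -innerDl -adj_zeta innerC -adjointP // innerC.
  have -> : F (u - udag) = (v - F udag) - al *: g.
    rewrite /g scalerA divff ?gt_eqF // scale1r linearB opprB.
    by rewrite [RHS]addrC addrA subrK.
  have zg : inner zeta g = h ^+ 2 + inner zeta (F y).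
    by rewrite /h -inner_normE -innerDr /zeta subrK.
  by rewrite (innerBr zeta (v - F udag)) innerZr zg; ring.
have zeta_v : inner zeta (v - F udag) <= h * d.
  by apply: (le_trans (inner_le _ _)); rewrite ler_wpM2l.
have young : h * d <= 2^-1 * al * h ^+ 2 + 2^-1 * (d ^+ 2 / al).
  have : 0 <= 2^-1 * al * (h - d / al) ^+ 2.
    by apply: mulr_ge0; [rewrite mulr_ge0 // ltW|exact: sqr_ge0].
  have -> : 2^-1 * al * (h - d / al) ^+ 2 =
    2^-1 * al * h ^+ 2 + 2^-1 * (d ^+ 2 / al) - h * d by field; rewrite gt_eqF.
  by rewrite subr_ge0.
pose B := `|om| * (2 * N) `^ (2 * nu - 1).
have B0 : 0 <= B by rewrite mulr_ge0 ?powR_ge0.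
have zeta_y : - inner zeta (F y) <= B * h `^ (2 - 2 * nu).
  apply: le_trans (_ : `|inner zeta (F y)| <= _); first by rewrite -normrN ler_norm.
  apply: le_trans (inner_regularised_source zeta s0 yE) _.
  rewrite /B -mulrA ler_wpM2l // ler_wpM2r ?powR_ge0 //.
  apply: ge0_ler_powR; rewrite ?nnegrE ?mulr_ge0 //; first lra.
  rewrite adj_zeta; apply: (le_trans (ler_normD _ _)); rewrite -/N; lra.
have := powR_absorb (normr_ge0 zeta) B0 th0 th2; rewrite -/h (powR_mulrn 2 h0).
have -> : B `^ (2 / (2 - (2 - 2 * nu))) =
    `|om| `^ nu^-1 * (2 `^ ((2 * nu - 1) / nu) * N `^ ((2 * nu - 1) / nu)).
  have -> : 2 / (2 - (2 - 2 * nu)) = nu^-1 by field; lra.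
  by rewrite /B powRM ?powR_ge0 // -powRrM powRM.
rewrite mulrA -/K1 => absorb.
have zy : - (al * inner zeta (F y)) <= al * (4^-1 * h ^+ 2 +
    K1 * (2 `^ ((2 * nu - 1) / nu) * N `^ ((2 * nu - 1) / nu))).
  by rewrite -mulrN ler_pM2l //; apply: le_trans zeta_y absorb.
have hh : 0 <= al * h ^+ 2 by rewrite mulr_ge0 ?sqr_ge0 // ltW.
move: identity zeta_v young zy sy2 hh.
move: (inner zeta _) (inner zeta (F y)) (inner (s *: y) _).
move: (h * d) (h ^+ 2) (d ^+ 2 / al).
move: (2 `^ _) (N `^ _) (K1).
move=> *; lra.
Qed.

End HighOrder.

(** * The degenerate endpoint *)

Section OneCoconvex.
Context {R : realType} {U : hilbertType R} (J : U -> \bar R).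
Hypothesis J_ge0 : forall u, (0 <= J u)%E.
Hypothesis J_convex : convex_functional J.
Hypothesis J_lsc : lower_semicontinuous J.

(** The subgradient of J at the minimiser of J + |. - z|^2 / 2, which is the
Tikhonov functional for the identity operator. *)
Lemma proximal_point (z u0 : U) : (J u0 < +oo)%E ->
  exists u, subdifferential J u (z - u).
Proof.
move=> Ju0.
pose g (u : U) := 2^-1 * `|u - z| ^+ 2.
have tikE u : tikhonov (idfun : U -> U) J 1 z u = (J u + (g u)%:E)%E.
  by rewrite /tikhonov mul1e addeC.
have gc : continuous g.
  move=> x; apply: cvgM; first exact: cvg_cst.
  apply: (@sqr_norm_continuous _ U U (fun u => u - z)) => y.
  by apply: cvgB; [exact: cvg_id|exact: cvg_cst].
have [u umin] : exists u, forall w, (J u + (g u)%:E <= J w + (g w)%:E)%E.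
  have k0 : 0 < 8^-1 :> R by [].
  apply: (strongly_convex_minimiser (c := 0) k0).
  - by move=> u; rewrite adde_ge0 // lee_fin mulr_ge0 ?sqr_ge0.
  - exact: lower_semicontinuous_addc.
  - exists u0; have [j _ ->] := lty_real (J_ge0 u0) Ju0.
    by rewrite -EFinD ltry.
  move=> u w a b.
  have fin x r : (J x + (g x)%:E <= r%:E)%E -> exists j, J x = j%:E.
    by move: (J_ge0 x); case: (J x) => [j| |] //; exists j.
  move=> ua wb; have [j jE] := fin _ _ ua; have [k kE] := fin _ _ wb.
  have h1 : 0 < 2^-1 :> R by [].
  have h2 : 2^-1 < 1 :> R by rewrite invf_lt1 // ltr1n.
  have := J_convex u w h1 h2.
  have -> : 2^-1 *: u + (1 - 2^-1) *: w = 2^-1 *: (u + w).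
    by rewrite scalerDr; congr (_ + _ *: _); field.
  rewrite jE kE -!EFinM -EFinD => mid.
  apply: (le_trans (leeD mid (lexx _))); rewrite -EFinD lee_fin.
  move: ua wb; rewrite jE kE -!EFinD !lee_fin /g.
  have -> : 2^-1 *: (u + w) - z = 2^-1 *: ((u - z) + (w - z)).
    rewrite addrACA -opprD -mulr2n -[z *+ 2]scaler_nat scalerBr scalerA mulVf //.
    by rewrite scale1r.
  rewrite midpoint_sqr.
  have -> : u - z - (w - z) = u - w by rewrite opprB addrA subrK.
  lra.
exists u; split.
  have [j _ jE] := lty_real (J_ge0 u0) Ju0.
  have := umin u0; rewrite jE -EFinD.
  by move: (J_ge0 u); case: (J u) => [k| |] //; rewrite ltry.
move=> w.
have min : tikhonov_minimiser (idfun : U -> U) J 1 z u.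
  by move=> x; rewrite !tikE.
have := tikhonov_optimality J_ge0 (F := idfun) w J_convex ltr01 Ju0 min.
by rewrite invr1 mul1r.
Qed.

(** If J is locally 1-coconvex, nearby points have equal subgradients; the
proximal map then makes the subgradient constant, so J is affine.  A
nonnegative affine functional is constant, and it is coercive only on the zero
space. *)
Lemma coconvex_order1_trivial (u0 : U) : (J u0 < +oo)%E -> coercive J ->
  locally_coconvex_of_order 1 J -> forall u : U, u = 0.
Proof.
move=> Ju0 Jco Jcc.
have [P PP] := choice (fun z => proximal_point z Ju0).
pose xi z := z - P z.
have mono z1 z2 : 0 <= inner (xi z1 - xi z2) (P z1 - P z2).
  have [_ s1] := PP z1; have [_ s2] := PP z2.
  have [j1 _ j1E] := lty_real (J_ge0 _) (PP z1).1.
  have [j2 _ j2E] := lty_real (J_ge0 _) (PP z2).1.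
  have := s1 (P z2); have := s2 (P z1); rewrite j1E j2E !lee_fin -!/(xi _).
  by rewrite innerBl -[P z2 - P z1]opprB innerNr; lra.
have P_lip z1 z2 : `|P z1 - P z2| <= `|z1 - z2|.
  rewrite -(@ler_pXn2r _ 2) ?nnegrE //.
  have -> : z1 - z2 = (xi z1 - xi z2) + (P z1 - P z2).
    by rewrite /xi addrACA -opprD !subrK.
  rewrite (normD_sqr (xi z1 - xi z2)) lerDr addr_ge0 ?sqr_ge0 //.
  by rewrite mulr_ge0.
have xi_const z : xi z = xi 0.
  have rho0 : 0 < `|P 0| + `|z| + 1 by rewrite ltr_wpDl // addr_ge0.
  have [C C0 hC] := Jcc _ rho0.
  (* The segment from 0 to z is cut into n + 1 steps shorter than C. *)
  have [n zn] : exists n, `|z| / n.+1%:R < C.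
    have e0 : 0 < C / (`|z| + 1) by rewrite divr_gt0 // ltr_wpDl.
    have [N _ NP] := near_infty_natSinv_lt (PosNum e0).
    exists N; have := NP N (leqnn N) => /=; rewrite ltr_pdivlMr ?ltr_wpDl //.
    by apply: le_lt_trans; rewrite mulrC ler_wpM2l ?invr_ge0 // lerDl.
  have step t1 t2 : 0 <= t1 -> t1 <= 1 -> 0 <= t2 -> t2 <= 1 ->
      `|t1 - t2| * `|z| < C -> xi (t1 *: z) = xi (t2 *: z).
    move=> a1 b1 a2 b2 t12.
    have Pb t : 0 <= t -> t <= 1 -> `|P (t *: z)| <= `|P 0| + `|z| + 1.
      move=> a b; have := P_lip (t *: z) 0; rewrite subr0 normrZ ger0_norm // => h.
      have := ler_normD (P 0) (P (t *: z) - P 0); rewrite addrC subrK.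
      by have := ler_wpM2r (normr_ge0 z) b; lra.
    have dom s : dom_subdifferential J (P s) by exists (xi s); exact: PP.
    have := hC _ _ _ _ (dom _) (dom _) (Pb _ a1 b1) (Pb _ a2 b2) (PP _) (PP _).
    rewrite powRr1 // -!/(xi _) => h.
    apply/eqP; rewrite -subr_eq0 -normr_eq0; apply: contraTT h => ne.
    have N0 : 0 < `|xi (t1 *: z) - xi (t2 *: z)| by rewrite lt_neqAle eq_sym ne /=.
    rewrite -ltNge; apply: (le_lt_trans (inner_le _ _)).
    rewrite mulrC ltr_pM2r //; apply: le_lt_trans t12.
    by apply: (le_trans (P_lip _ _)); rewrite -scalerBl normrZ.
  have all_k k : (k <= n.+1)%N -> xi ((k%:R / n.+1%:R) *: z) = xi 0.
    elim: k => [_|k IH kn]; first by rewrite mul0r scale0r.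
    have n0 : 0 < n.+1%:R :> R by [].
    rewrite -(IH (ltnW kn)); apply: step.
    + by rewrite divr_ge0.
    + by rewrite ler_pdivrMr // mul1r ler_nat.
    + by rewrite divr_ge0.
    + by rewrite ler_pdivrMr // mul1r ler_nat ltnW.
    by rewrite -mulrBl -natrB // subSnn mul1r ger0_norm ?invr_ge0 // mulrC.
  by have := all_k _ (leqnn _); rewrite divff // scale1r.
have sub u : subdifferential J u (xi 0).
  have Pu : P (u + xi 0) = u.
    have -> : P (u + xi 0) = u + xi 0 - xi (u + xi 0) by rewrite [in RHS]/xi subKr.
    by rewrite xi_const addrK.
  by have := PP (u + xi 0); rewrite Pu addrAC subrr add0r.
have [j0 j00 j0E] := lty_real (J_ge0 0) (sub 0).1.
have affine w : J w = (j0 + inner (xi 0) w)%:E.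
  have [j _ jE] := lty_real (J_ge0 w) (sub w).1.
  have := (sub 0).2 w; have := (sub w).2 0; rewrite j0E jE !lee_fin subr0 sub0r innerNr.
  by move=> h1 h2; congr EFin; lra.
have xi00 : xi 0 = 0.
  apply: inner_eq0; set i := inner _ _.
  have i0 : 0 <= i by rewrite /i inner_normE sqr_ge0.
  apply/eqP; rewrite eq_le i0 andbT leNgt; apply/negP => ip.
  have := J_ge0 (- ((j0 + 1) / i) *: xi 0); rewrite affine lee_fin innerZr -/i.
  by rewrite mulNr divfK ?gt_eqF //; lra.
move=> u; apply/eqP; apply: contraT => un.
have U0 : 0 < `|u| by rewrite normr_gt0.
have [r hr] := Jco (j0 + 1).
have := hr ((`|r| / `|u|) *: u).
rewrite normrZ ger0_norm ?divr_ge0 // divfK ?gt_eqF // affine xi00 inner0l.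
by move=> /(_ (ler_norm r)); rewrite lee_fin; lra.
Qed.

End OneCoconvex.

(** * The rate under coconvexity *)

Section HighRate.
Context {R : realType} {U V : hilbertType R} (F : {linear U -> V}).
Variable J : U -> \bar R.
Hypothesis Fb : bounded_op F.
Hypothesis J_ge0 : forall u, (0 <= J u)%E.
Hypothesis J_convex : convex_functional J.
Hypothesis J_lsc : lower_semicontinuous J.
Hypothesis J_coercive : coercive J.
Variables (udag xi : U).
Hypothesis xi_sub : subdifferential J udag xi.
Variables (nu : R) (om : U).
Hypothesis nu_gt0 : 0 < nu.
Hypothesis source : xi = op_power (adjoint F \o F) nu om.

(** Coconvexity turns the factor |xi_alpha - xi|^((2 nu - 1) / nu) into a power
of the Bregman distance with exponent (2 nu - 1) / (q nu), which is less than 1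
except for q = nu = 1, where the space is trivial. *)
Lemma rate_high_smoothness (q : R) : 1 <= q -> locally_coconvex_of_order q J ->
  2^-1 <= nu -> nu <= 1 ->
  convergence_rate F J (F udag)
    ((2 + 2 * nu * q - 4 * nu) / (1 + 2 * nu * q - 2 * nu))
    (2 * nu * q / (1 + 2 * nu * q - 2 * nu))
    (fun alpha v u =>
       (bregman_sym (tikhonov_subgradient F alpha v u) xi u udag)%:E).
Proof.
move=> q1 Jcc nu2 nu1 c c' c0 cc'.
have nu0 := nu_gt0; have [Ju0 _] := xi_sub.
have den : 0 < 1 + 2 * nu * q - 2 * nu by nra.
set a := _ / _; set b := _ / _.
have [[q1E nu1E]|q_nu] := pselect (q = 1 /\ nu = 1).
  rewrite q1E in Jcc.
  have triv := coconvex_order1_trivial J_ge0 J_convex J_lsc Ju0 J_coercive Jcc.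
  exists 1, 1; split => // d al v u d0 _ _ _ _ _.
  by rewrite lee_fin /bregman_sym [u - udag]triv inner0r mul1r powR_ge0.
have bE : b = 2 - a by rewrite /a /b; field; rewrite gt_eqF.
have b0 : 0 <= b by rewrite /b divr_ge0 // ?(ltW den) //; nra.
have a2 : a <= 2 by move: b0; rewrite bE subr_ge0.
have qnu : 0 < q * nu by rewrite mulr_gt0 // (lt_le_trans ltr01).
have num : 2 * nu - 1 < q * nu.
  rewrite lt_neqAle; apply/andP; split; last by nra.
  apply/eqP => E; apply: q_nu; have nuE : nu = 1 by nra.
  by split => //; move: E; rewrite nuE; lra.
pose r := (2 * nu - 1) / (q * nu).
have r0 : 0 <= r by rewrite divr_ge0 ?(ltW qnu) //; lra.
have r1 : r < 1 by rewrite ltr_pdivrMr // mul1r.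
have abE : a * (1 / (1 - r)) = b.
  have d1 : q * nu - (2 * nu - 1) != 0 by rewrite subr_eq0 gt_eqF.
  rewrite /a /b /r; field.
  by rewrite d1 !gt_eqF // (lt_le_trans ltr01).
have [rho rho0 hrho] := tikhonov_minimisers_bounded F J_ge0 J_coercive xi_sub c0 a2.
have rho'0 : 0 < rho + `|udag| by rewrite ltr_wpDr.
have [C1 C10 hC1] := Jcc _ rho'0.
have [K K0 hK] := bregman_sym_estimate Fb nu_gt0 nu2 nu1 source.
pose K1 := K * C1^-1 `^ r.
have K10 : 0 <= K1 by rewrite mulr_ge0 ?powR_ge0.
have [C C0 hC] := rate_of_absorption c0 cc' K10 ler01 r0 r1 bE abE.
exists 1, C; split => // d al v u d0 d1 al1 al2 vd min.
have da : 0 < d `^ a by rewrite powR_gt0.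
have al0 : 0 < al by apply: lt_le_trans al1; rewrite mulr_gt0.
have xia_sub := tikhonov_subgradientP J_ge0 Fb J_convex al0 Ju0 min.
have main := hK al d v u udag al0 vd _ _ erefl erefl.
set xia := tikhonov_subgradient F al v u in xia_sub main *.
set D := bregman_sym xia xi u udag in main *.
have u_le : `|u| <= rho + `|udag|.
  by apply: (le_trans (hrho d al v u d0 d1 al1 vd min)); rewrite lerDl.
have udag_le : `|udag| <= rho + `|udag| by rewrite lerDr ltW.
have coc : C1 * `|xia - xi| `^ q <= D.
  by apply: hC1; rewrite //; [exists xia|exists xi].
have D0 : 0 <= D by apply: le_trans coc; rewrite mulr_ge0 ?powR_ge0 // ltW.
rewrite lee_fin; apply: (hC d al D) => //; apply: (le_trans main).
rewrite lerD2l (powRr1 (ltW al0)) /K1.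
have -> : K * C1^-1 `^ r * al * D `^ r = al * (K * (C1^-1 `^ r * D `^ r)) by ring.
rewrite ler_pM2l //; apply: ler_wpM2l => //.
rewrite -powRM ?invr_ge0 ?(ltW C10) //.
have -> : (2 * nu - 1) / nu = q * r.
  by rewrite /r; field; rewrite !gt_eqF // (lt_le_trans ltr01).
rewrite powRrM; apply: ge0_ler_powR; rewrite ?nnegrE ?powR_ge0 //.
  by rewrite mulr_ge0 // invr_ge0 ltW.
by rewrite ler_pdivlMl.
Qed.

End HighRate.

(** * The three rates *)

Theorem theorem1 (R : realType) (U V : hilbertType R)
    (F : {linear U -> V}) (F_bounded : bounded_op F)
    (J : U -> \bar R) (J_ge0 : forall u, (0 <= J u)%E)
    (J_convex : convex_functional J) (J_lsc : lower_semicontinuous J)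
    (J_coercive : coercive J)
    (vdag : V) (udag : U) (udag_min : constrained_minimiser F J vdag udag)
    (nu : R) (nu_gt0 : 0 < nu) (nu_le1 : nu <= 1)
    (omegadag xidag : U)
    (source : xidag = op_power (adjoint F \o F) nu omegadag)
    (xidag_sub : subdifferential J udag xidag) :
  [/\ nu <= 2^-1 ->
        convergence_rate F J vdag (2 - 2 * nu) (2 * nu)
          (fun _ _ u => bregman J xidag u udag),
      forall p : R, 1 <= p -> locally_convex_of_order p J -> nu <= 2^-1 ->
        convergence_rate F J vdag
          ((2 * p - 2 - 2 * p * nu + 4 * nu) / (p - 1 + 2 * nu))
          (2 * nu * p / (p - 1 + 2 * nu))
          (fun _ _ u => bregman J xidag u udag)
    & forall q : R, 1 <= q -> locally_coconvex_of_order q J -> 2^-1 <= nu ->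
        (forall (alpha : R) (v : V) (u : U), 0 < alpha ->
           tikhonov_minimiser F J alpha v u ->
           subdifferential J u (tikhonov_subgradient F alpha v u)) /\
        convergence_rate F J vdag
          ((2 + 2 * nu * q - 4 * nu) / (1 + 2 * nu * q - 2 * nu))
          (2 * nu * q / (1 + 2 * nu * q - 2 * nu))
          (fun alpha v u =>
             (bregman_sym (tikhonov_subgradient F alpha v u) xidag u udag)%:E)].
Proof.
have Fu : F udag = vdag by case: udag_min.
have [Ju0 _] := xidag_sub.
rewrite -Fu; split.
- move=> nu2.
  apply: (rate_low_smoothness F_bounded J_ge0 J_coercive xidag_sub nu_gt0 source
    (s := 0) nu2) => //; try lra.
    by rewrite mul0r subr0 divr1; field; lra.
  move=> rho rho0; exists (rho `^ (1 - 2 * nu)); first exact: powR_ge0.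
  move=> u D u_rho _ _; rewrite powRr0 mulr1.
  by apply: ge0_ler_powR; rewrite ?nnegrE // ?(ltW rho0) //; lra.
- move=> p p1 Jp nu2.
  have p0 : 0 < p by lra.
  have den : 0 < p - 1 + 2 * nu by lra.
  have snu : (1 - 2 * nu) / p < 1 - nu by rewrite ltr_pdivrMr //; nra.
  apply: (rate_low_smoothness F_bounded J_ge0 J_coercive xidag_sub nu_gt0 source
    (s := (1 - 2 * nu) / p) nu2) => //.
  + by rewrite divr_ge0 //; lra.
  + by field; lra.
  + by rewrite divr_ge0 ?(ltW den) // !mulr_ge0 //; lra.
  + have h1 : 0 < 1 - nu by lra.
    have h2 : 0 < p * (1 - nu) - (1 - 2 * nu) by nra.
    by field; rewrite !gt_eqF //=; lra.
  move=> rho rho0.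
  have dom : dom_subdifferential J udag by exists xidag.
  have [C C0 hC] := Jp _ dom _ rho0.
  exists (C^-1 `^ ((1 - 2 * nu) / p)); first exact: powR_ge0.
  move=> u D u_rho DE D0.
  have := hC _ _ xidag_sub u_rho; rewrite DE lee_fin => h.
  rewrite -powRM ?invr_ge0 ?(ltW C0) //.
  have {1}-> : 1 - 2 * nu = p * ((1 - 2 * nu) / p) by field; lra.
  rewrite powRrM; apply: ge0_ler_powR; rewrite ?nnegrE ?powR_ge0 //.
  + by rewrite divr_ge0 //; lra.
  + by rewrite mulr_ge0 // invr_ge0 ltW.
  by rewrite ler_pdivlMl.
- move=> q q1 Jq nu2; split.
    move=> alpha v u alpha0 min.
    exact: (tikhonov_subgradientP J_ge0 F_bounded J_convex alpha0 Ju0 min).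
  exact: (rate_high_smoothness F_bounded J_ge0 J_convex J_lsc J_coercive xidag_sub
    nu_gt0 source q1 Jq nu2 nu_le1).
Qed.
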